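(* Let $\Sigma\subset\mathbb R^2$ be a damping set, $S:\mathbb R\rightrightarrows\mathbb R$ the set-valued map whose graph is $R\Sigma$, and $p\in[1,+\infty]$. (a) If $p<+\infty$, then the wave equation associated with $\Sigma$ is strongly stable in $\mathsf X_p$ if and only if real iterated sequences for $S$ converge simply to zero. (b) For $p=+\infty$, the following statements are equivalent: (b-i) the wave equation associated with $\Sigma$ is UGAS in $\mathsf X_\infty$; (b-ii) the wave equation associated with $\Sigma$ is strongly stable in $\mathsf X_\infty$; (b-iii) real iterated sequences for $S$ converge uniformly to zero.
   Context: Notation: $\mathbb R_+=[0,+\infty)$, $\mathbb N=\{0,1,2,\dots\}$, $R=\begin{pmatrix}\frac1{\sqrt2}&\frac1{\sqrt2}\\-\frac1{\sqrt2}&\frac1{\sqrt2}\end{pmatrix}$ and $R\Sigma=\{R\xi:\xi\in\Sigma\}$. The graph of $S:\mathbb R\rightrightarrows\mathbb R$ is $\{(x,y):y\in S(x)\}$. $L^p_{\mathrm{loc}}(a,+\infty)$ is the set of measurable functions whose restriction to $(a,T)$ is in $L^p$ for every $T>a$. $W^{1,p}_*(0,1)=\{u\in L^p(0,1): u'\in L^p(0,1),\ u(0)=0\}$ and $\mathsf X_p=W^{1,p}_*(0,1)\times L^p(0,1)$, with norm $\|(u,v)\|_{\mathsf X_p}^p=2^{-p/2}\int_0^1(|u'+v|^p+|u'-v|^p)\,dx$ if $p<+\infty$ and $\|(u,v)\|_{\mathsf X_\infty}=\frac1{\sqrt2}\max(\|u'+v\|_{L^\infty(0,1)},\|u'-v\|_{L^\infty(0,1)})$.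 The wave equation associated with $\Sigma$ is: $z_{tt}=z_{xx}$ on $\mathbb R_+\times[0,1]$; $z(t,0)=0$ and $(z_t(t,1),-z_x(t,1))\in\Sigma$ for $t\in\mathbb R_+$; $z(0,x)=z_0(x)$, $z_t(0,x)=z_1(x)$ for $x\in[0,1]$. A (weak, global in time) solution in $\mathsf X_p$ with initial condition $(z_0,z_1)\in\mathsf X_p$ is a function $z:\mathbb R_+\times[0,1]\to\mathbb R$ for which there exist $f\in L^p_{\mathrm{loc}}(0,+\infty)$ and $g\in L^p_{\mathrm{loc}}(-1,+\infty)$ such that $z(t,x)=\frac1{\sqrt2}\int_0^{t+x}f+\frac1{\sqrt2}\int_0^{t-x}g$ for all $(t,x)\in\mathbb R_+\times[0,1]$, $z(t,0)=0$ and $(z_t(t,1),-z_x(t,1))\in\Sigma$ for a.e. $t\in\mathbb R_+$, and $z(0,x)=z_0(x)$, $z_t(0,x)=z_1(x)$ for a.e. $x\in[0,1]$; here $z_t(t,x)=\frac{f(t+x)+g(t-x)}{\sqrt2}$ and $z_x(t,x)=\frac{f(t+x)-g(t-x)}{\sqrt2}$. Set $e_p(z)(t)=\|(z(t,\cdot),z_t(t,\cdot))\|_{\mathsf X_p}$. Damping set: $\Sigma$ is a damping set if $(0,0)\in\Sigma$, $xy\ge0$ for every $(x,y)\in\Sigma$, and $R\Sigma$ contains the graph of a universally measurable function $\varphi:\mathbb R\to\mathbb R$ with linear growth ($|\varphi(x)|\le a|x|+b$ for some $a,b\ge0$). A set $M\subset\mathbb R$ is universally measurable if for every Borel probability measure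 $\nu$ on $\mathbb R$ there exist Borel sets $A\subset M\subset B$ with $\nu(B\setminus A)=0$; $\varphi$ is universally measurable if preimages of Borel sets are universally measurable. (For a damping set, solutions exist for every initial condition in $\mathsf X_p$.) Stability: the wave equation is strongly stable in $\mathsf X_p$ if every solution $z$ in $\mathsf X_p$ (for every initial condition in $\mathsf X_p$) satisfies $\lim_{t\to+\infty}e_p(z)(t)=0$. It is UGAS (uniformly globally asymptotically stable) in $\mathsf X_p$ if there is a $\mathcal{KL}$ function $\beta$ such that $e_p(z)(t)\le\beta(e_p(z)(0),t)$ for all $t\ge0$ and every solution $z$ in $\mathsf X_p$. A $\mathcal{KL}$ function is a continuous $\beta:\mathbb R_+\times\mathbb R_+\to\mathbb R_+$ such that for each $t$, $\beta(\cdot,t)$ is increasing with $\beta(0,t)=0$, and for each $x$, $\beta(x,\cdot)$ is decreasing and tends to $0$ at $+\infty$ (for $x=0$, $\beta(0,\cdot)\equiv0$). Real iterated sequences: a real iterated sequence for $S$ is a real sequence $(x_n)_{n\in\mathbb N}$ with $x_{n+1}\in S(x_n)$ for all $n$. Real iterated sequences for $S$ converge simply to zero if every real iterated sequence converges to zero. They converge uniformly to zero if for every $r\ge0$ and $\varepsilon>0$ there exists $N\in\mathbb N$ such that for every $x\in\mathbb R$ with $|x|\le r$ and every real iterated sequence $(x_n)$ for $S$ with $x_0=x$, one has $|x_n|<\varepsilon$ for every $n\ge N$. *)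

(* Defs.v *)
From HB Require Import structures.
From mathcomp Require Import all_boot all_order all_algebra.
From mathcomp Require Import all_classical all_reals all_analysis.

Set Implicit Arguments.
Unset Strict Implicit.
Unset Printing Implicit Defensive.

Import Order.TTheory GRing.Theory Num.Theory.
Import numFieldNormedType.Exports.

Local Open Scope classical_set_scope.
Local Open Scope ring_scope.

Section Damping.
Context {R : realType}.

(* Multiplication by the matrix with rows (1/sqrt 2, 1/sqrt 2) and
   (- 1/sqrt 2, 1/sqrt 2), i.e. the rotation of angle - pi/4. *)
Definition rotation (xi : R * R) : R * R :=
  ((Num.sqrt 2)^-1 * xi.1 + (Num.sqrt 2)^-1 * xi.2,
   - (Num.sqrt 2)^-1 * xi.1 + (Num.sqrt 2)^-1 * xi.2).

(* A set-valued map from R to R is a function R -> set R. *)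
Definition graph_of (S : R -> set R) : set (R * R) := [set q | S q.1 q.2].

Definition universally_measurable_set (M : set R) : Prop :=
  forall nu : probability (measurableTypeR R) R,
    exists A B : set (measurableTypeR R),
      [/\ measurable A, measurable B, A `<=` M, M `<=` B
        & nu (B `\` A) = 0%E].

Definition universally_measurable_fun (phi : R -> R) : Prop :=
  forall B : set (measurableTypeR R), measurable B ->
    universally_measurable_set (phi @^-1` B).

Definition linear_growth (phi : R -> R) : Prop :=
  exists a b : R, [/\ 0 <= a, 0 <= b & forall x, `|phi x| <= a * `|x| + b].

Definition damping_set (Sigma : set (R * R)) : Prop :=
  [/\ Sigma (0, 0),
      forall x y, Sigma (x, y) -> 0 <= x * y
    & exists phi : R -> R,
        [/\ universally_measurable_fun phi, linear_growth phi
          & forall x, (rotation @` Sigma) (x, phi x)]].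

Definition iterated_sequence (S : R -> set R) (x : nat -> R) : Prop :=
  forall n, S (x n) (x n.+1).

Definition converge_simply_to_zero (S : R -> set R) : Prop :=
  forall x : nat -> R, iterated_sequence S x -> x n @[n --> \oo] --> 0.

Definition converge_uniformly_to_zero (S : R -> set R) : Prop :=
  forall r eps : R, 0 <= r -> 0 < eps ->
    exists N : nat, forall x0 : R, `|x0| <= r ->
      forall x : nat -> R, iterated_sequence S x -> x 0%N = x0 ->
        forall n, (N <= n)%N -> `|x n| < eps.

End Damping.

Section FunctionSpaces.
Context {R : realType}.
Local Notation mu := (@lebesgue_measure R).

(* f restricted to the open interval (a, b) belongs to L^p; the restriction is
   encoded as the extension of f by zero outside (a, b).  As everywhere in the
   library, measurable means Borel measurable: an element of L^p is given by
   a Borel representative, and every class of Lebesgue measurable functions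
   modulo a.e. equality has one. *)
Definition in_Lp (p : \bar R) (a b : R) (f : R -> R) : Prop :=
  (f \_ `]a, b[) \in Lfun mu p.

Definition in_Lploc (p : \bar R) (a : R) (f : R -> R) : Prop :=
  forall T, a < T -> in_Lp p a T f.

(* Test functions: C^1 with compact support in (0, 1). *)
Definition test_function (phi : R -> R) : Prop :=
  [/\ forall x, derivable phi x 1, continuous (derive1 phi)
    & exists a b, [/\ 0 < a, b < 1 & forall x, ~ (a <= x <= b) -> phi x = 0]].

(* w is the weak derivative of u on (0, 1). *)
Definition is_weak_derivative (u w : R -> R) : Prop :=
  locally_integrable `]0, 1[ w /\
  forall phi, test_function phi ->
    \int[mu]_(x in `]0, 1[) (u x * derive1 phi x) =
    - \int[mu]_(x in `]0, 1[) (w x * phi x).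

(* A chosen representative, unique up to a.e. equality; the zero function if
   u is not weakly differentiable. *)
Definition weak_derivative (u : R -> R) : R -> R :=
  xget (cst 0) [set w | is_weak_derivative u w].

(* The condition u(0) = 0 refers to the continuous representative on [0, 1],
   with which an element of W^{1,p}(0, 1) is identified. *)
Definition in_W1p_star (p : \bar R) (u : R -> R) : Prop :=
  [/\ {within `[0, 1], continuous u}, in_Lp p 0 1 u,
      exists2 w, is_weak_derivative u w & in_Lp p 0 1 w
    & u 0 = 0].

Definition in_X (p : \bar R) (uv : (R -> R) * (R -> R)) : Prop :=
  in_W1p_star p uv.1 /\ in_Lp p 0 1 uv.2.

(* The norm of L^oo(0, 1), as the library's norm on R of the extension by zero
   of f. *)
Definition Loo_norm (f : R -> R) : \bar R :=
  ('N[mu]_+oo[EFin \o (f \_ `]0%R, 1%R[)])%E.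

(* Only 1 <= p <= +oo is meaningful.  The value is an extended real, finite on
   in_X p. *)
Definition X_norm (p : \bar R) (uv : (R -> R) * (R -> R)) : \bar R :=
  let du := weak_derivative uv.1 in
  let v := uv.2 in
  match p with
  | q%:E =>
      (((2 `^ (- (q / 2)))%R%:E *
        \int[mu]_(x in `]0%R, 1%R[)
           (`|du x + v x| `^ q + `|du x - v x| `^ q)%R%:E) `^ q^-1)%E
  | +oo%E =>
      (((Num.sqrt 2)^-1)%R%:E *
       maxe (Loo_norm (fun x => du x + v x)%R)
            (Loo_norm (fun x => du x - v x)%R))%E
  | -oo%E => 0%E
  end.

Definition oriented_integral (a b : R) (f : R -> R) : R :=
  if a <= b then \int[mu]_(s in `[a, b]) f s
  else - \int[mu]_(s in `[b, a]) f s.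

End FunctionSpaces.

Section Wave.
Context {R : realType}.
Local Notation mu := (@lebesgue_measure R).

Definition wave_t (f g : R -> R) (t x : R) : R :=
  (f (t + x) + g (t - x)) / Num.sqrt 2.

Definition wave_x (f g : R -> R) (t x : R) : R :=
  (f (t + x) - g (t - x)) / Num.sqrt 2.

(* z is a weak solution with initial condition (z0, z1), represented by f and
   g.  Only the values z t x with 0 <= t and 0 <= x <= 1 matter.  The pair
   (f, g) is exposed because z_t and z_x are defined through it; z determines
   z_t(t, .) up to a.e. equality for every t >= 0. *)
Definition solution (Sigma : set (R * R)) (p : \bar R)
    (z0 z1 : R -> R) (z : R -> R -> R) (f g : R -> R) : Prop :=
  [/\ in_Lploc p 0 f, in_Lploc p (-1) g,
      forall t x, 0 <= t -> 0 <= x <= 1 ->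
        z t x = (Num.sqrt 2)^-1 * oriented_integral 0 (t + x) f
              + (Num.sqrt 2)^-1 * oriented_integral 0 (t - x) g,
      \forall t \ae mu, 0 <= t ->
        z t 0 = 0 /\ Sigma (wave_t f g t 1, - wave_x f g t 1)
    & \forall x \ae mu, 0 <= x <= 1 ->
        z 0 x = z0 x /\ wave_t f g 0 x = z1 x].

Definition energy (p : \bar R) (z : R -> R -> R) (f g : R -> R) (t : R)
  : \bar R := X_norm p (z t, wave_t f g t).

Definition strongly_stable (Sigma : set (R * R)) (p : \bar R) : Prop :=
  forall (z0 z1 : R -> R) (z : R -> R -> R) (f g : R -> R),
    in_X p (z0, z1) -> solution Sigma p z0 z1 z f g ->
    energy p z f g t @[t --> +oo%R] --> 0%E.

(* Increasing and decreasing are strict; for x = 0 the function beta(0, .)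
   is identically zero. *)
Definition KL (beta : R -> R -> R) : Prop :=
  [/\ {within [set q : R * R | 0 <= q.1 /\ 0 <= q.2],
        continuous (fun q : R * R => beta q.1 q.2)},
      forall x t, 0 <= x -> 0 <= t -> 0 <= beta x t,
      forall t, 0 <= t -> beta 0 t = 0 /\
        (forall x y, 0 <= x -> x < y -> beta x t < beta y t),
      forall x, 0 < x ->
        forall s t, 0 <= s -> s < t -> beta x t < beta x s
    & forall x, 0 <= x -> beta x t @[t --> +oo%R] --> 0].

(* The initial energy of a solution is finite, so fine loses nothing; the
   left-hand side of the estimate is kept as an extended real. *)
Definition UGAS (Sigma : set (R * R)) (p : \bar R) : Prop :=
  exists2 beta : R -> R -> R, KL beta &
    forall (z0 z1 : R -> R) (z : R -> R -> R) (f g : R -> R),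
      in_X p (z0, z1) -> solution Sigma p z0 z1 z f g ->
      forall t, 0 <= t ->
        (energy p z f g t <= (beta (fine (energy p z f g 0)) t)%:E)%E.

End Wave.

(* Main.v *)
Require Import Defs.
From HB Require Import structures.
From mathcomp Require Import all_boot all_order all_algebra.
From mathcomp Require Import all_classical all_reals all_analysis.
From mathcomp Require Import measurable_realfun ess_sup_inf.
From mathcomp Require Import ring lra.

Set Implicit Arguments.
Unset Strict Implicit.
Unset Printing Implicit Defensive.

Import Order.TTheory GRing.Theory Num.Theory.
Import numFieldNormedType.Exports.

Local Open Scope classical_set_scope.
Local Open Scope ring_scope.

(** Write a solution as [z(t, x) = (\int_0^(t+x) f + \int_0^(t-x) g) / sqrt 2].
    The condition [z(t, 0) = 0] says that [f = - g] almost everywhere on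
    [(0, +oo)], and the boundary condition at [x = 1], read in the coordinates
    rotated by [- pi / 4], says that [g (t + 1)] belongs to [S (g (t - 1))].
    Hence for almost every [s] in [(-1, 1)] the values [g (s + 2 n)] form an
    iterated sequence of [S], and apart from integrability nothing else
    constrains [g] (reflection_at_zero, outgoing_iterates).  In the same
    coordinates the energy at time [t] is the [L^p] norm of [g] on the window
    [(t - 1, t + 1)] (energy_Lp, energy_Loo_leP).  The equivalences then compare
    iterated sequences with norms of [g] on windows of length two.

    Sufficiency.  Since [x * y >= 0] on the damping set, [S] does not increase
    absolute values, so the translates of [|g|^p] on [(-1, 1)] are dominated by
    the first one, and simple convergence gives strong stability for finite [p]
    by dominated convergence (Lp_window_cvg0).  For [p = +oo] uniform
    convergence bounds [|g (s + 2 n)|] in terms of [n] and of the initial norm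
    only; a regularized supremum over all iterated sequences turns this into a
    KL function (KL_KL_bound, le_KL_bound).

    Necessity.  Any bounded countable family of iterated sequences is realized
    by a solution: cut [(-1, 1)] into countably many intervals and let [g] run
    through one sequence of the family on each of them (step_profile,
    profile_wave_solution).  A single sequence, used everywhere, has an energy
    comparable to its absolute value, which gives simple convergence.  If
    uniform convergence fails, there are sequences from a fixed ball such that
    the [k]-th one is still large at index [k]; pasted together they form a
    solution of the problem in [L^oo] whose energy does not tend to zero.

    The energy is defined through a chosen weak derivative of [z(t, .)].  It is
    identified with the formal derivative by integration by parts for
    primitives of integrable functions, an instance of Fubini's theorem
    (weak_derivative_primitive), and by the fundamental lemma of the calculus of
    variations (weak_derivative_unique). *)

(** * Isometries of the line and Lebesgue measure *)

Section Isometries.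
Context {R : realType}.
Local Notation mu := (@lebesgue_measure R).

Lemma ae_imply (P Q : R -> Prop) :
  (forall x, P x -> Q x) -> {ae mu, forall x, P x} -> {ae mu, forall x, Q x}.
Proof. by move=> PQ; apply: (@filterS _ _ (ae_filter_ringOfSetsType mu)). Qed.

Lemma ae_imply2 (P1 P2 Q : R -> Prop) :
  (forall x, P1 x -> P2 x -> Q x) ->
  {ae mu, forall x, P1 x} -> {ae mu, forall x, P2 x} -> {ae mu, forall x, Q x}.
Proof. by move=> PQ; apply: (@filterS2 _ _ (ae_filter_ringOfSetsType mu)). Qed.

Lemma integrable_patch (D : set R) (w : R -> R) : measurable D ->
  mu.-integrable D (EFin \o w) <->
  mu.-integrable [set: R] (EFin \o (w \_ D)).
Proof. by move=> mD; rewrite -restrict_EFin; exact: integrable_mkcond. Qed.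

Lemma integrable_measurable_fun (D : set R) (w : R -> R) :
  mu.-integrable D (EFin \o w) -> measurable_fun D w.
Proof. by move=> /measurable_int /measurable_EFinP. Qed.

Definition measure_preserving (phi : R -> R) : Prop :=
  measurable_fun [set: R] phi /\
  forall A, measurable A -> mu (phi @^-1` A) = mu A.

(** Lebesgue measure is determined by its values on half-open intervals, whose
    lengths a translation preserves. *)
Lemma measure_preserving_shift (c : R) : measure_preserving (fun x => c + x).
Proof.
have mphi : measurable_fun [set: R] (fun x => c + x) by apply: measurable_funD.
split=> // A mA.
apply/esym.
pose phi : measurableTypeR R -> measurableTypeR R := fun x => c + x.
pose mmixin := @isMeasurableFun.Build _ _ (measurableTypeR R) (measurableTypeR R) phi mphi.
pose psi : {mfun measurableTypeR R >-> measurableTypeR R} :=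
  HB.pack phi mmixin.
apply: (@lebesgue_measure_unique R (pushforward mu psi)) => // _ [[a b]] _ <-.
rewrite -[RHS]/(mu (phi @^-1` `]a, b]%classic)).
rewrite (_ : phi @^-1` _ = `]a - c, b - c]%classic).
  rewrite !lebesgue_measure_itv/= !lte_fin ltrD2r.
  by case: ifP => // _; rewrite -!EFinD; congr EFin; ring.
by apply/seteqP; split=> x /=; rewrite !in_itv/= /phi; lra.
Qed.

Lemma measure_preserving_reflection (c : R) :
  measure_preserving (fun x => c - x).
Proof.
have [m1 p1] := measure_preserving_shift c.
split=> [|A mA]; first by apply: measurable_funB.
rewrite -(p1 A mA); apply: lebesgue_measureN.
by rewrite -[X in measurable X]setTI; exact: m1.
Qed.

Section Transport.
Variable phi : R -> R.
Hypothesis pphi : measure_preserving phi.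

Lemma measure_preserving_measurable A :
  measurable A -> measurable (phi @^-1` A).
Proof. by move=> mA; rewrite -[X in measurable X]setTI; exact: pphi.1. Qed.

Lemma ae_measure_preserving (P : R -> Prop) :
  {ae mu, forall x, P x} -> {ae mu, forall x, P (phi x)}.
Proof.
move=> [N [mN N0 PN]]; exists (phi @^-1` N); split.
- exact: measure_preserving_measurable.
- by rewrite pphi.2.
- by move=> x Px; apply: PN.
Qed.

Lemma ge0_integral_measure_preserving D (f : R -> \bar R) :
  measurable D -> measurable_fun D f -> {in D, forall y, 0 <= f y}%E ->
  (\int[mu]_(y in D) f y = \int[mu]_(x in phi @^-1` D) f (phi x))%E.
Proof.
move=> mD mf f0.
rewrite -[RHS](@ge0_integral_pushforward _ _ (measurableTypeR R) (measurableTypeR R) R phi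
  pphi.1 mu D f mD mf f0).
by apply: eq_measure_integral => [|mp A mA _]; [exact: pphi.1|exact/esym/pphi.2].
Qed.

Lemma integrable_measure_preserving D (f : R -> \bar R) :
  measurable D -> measurable_fun [set: R] f -> mu.-integrable D f ->
  mu.-integrable (phi @^-1` D) (f \o phi).
Proof.
move=> mD mf /integrableP[_ foo]; apply/integrableP; split.
  by apply: measurable_funTS; apply: measurableT_comp => //; exact: pphi.1.
rewrite -(ge0_integral_measure_preserving (f := fun x => `|f x|%E))//.
by apply: measurable_funTS; exact: measurableT_comp.
Qed.

Lemma Rintegral_measure_preserving D (f : R -> R) :
  measurable D -> measurable_fun [set: R] f ->
  mu.-integrable D (EFin \o f) ->
  \int[mu]_(y in D) f y = \int[mu]_(x in phi @^-1` D) f (phi x).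
Proof.
move=> mD mf fi; congr fine.
have mf' : measurable_fun [set: R] (EFin \o f) by exact/measurable_EFinP.
have fi' := integrable_measure_preserving mD mf' fi.
rewrite -[RHS](@integral_pushforward _ _ (measurableTypeR R) (measurableTypeR R) R phi
  pphi.1 mu D (EFin \o f) mf' fi' mD).
by apply: eq_measure_integral => [|mp A mA _]; [exact: pphi.1|exact/esym/pphi.2].
Qed.

End Transport.
End Isometries.

(** * Weak derivatives on the unit interval *)

Section Bumps.
Context {R : realType}.
Implicit Types c d x y : R.

(** The function [y |y|] is the building block of the test functions below:
    it is continuously differentiable, and [y |y| + y ^ 2] vanishes for
    [y <= 0]. *)
Lemma is_derive_sqr_sign (y : R) :
  is_derive y 1 (fun y : R => y * `|y|) (2 * `|y|).
Proof.
have [y0|y0|->] := ltgtP y 0.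
- apply: (@near_eq_is_derive _ R^o R^o (- ((@id R) ^+ 2))).
    near=> z; rewrite /GRing.opp/= exprfctE/=.
    by rewrite ltr0_norm ?mulrN ?expr2//; near: z; exact: lt_nbhsl.
  by apply: is_derive_eq; rewrite ltr0_norm// scaler1/= expr1 mulrN mulr_natl.
- apply: (@near_eq_is_derive _ R^o R^o ((@id R) ^+ 2)).
    near=> z; rewrite exprfctE/=.
    by rewrite gtr0_norm ?expr2//; near: z; exact: lt_nbhsr.
  by apply: is_derive_eq; rewrite gtr0_norm// scaler1/= expr1 mulr_natl.
- have H : (fun h : R => h^-1 * ((h * 1 + 0) * `|h * 1 + 0| - 0 * `|0 : R|)) @ 0^'
      --> (0 : R).
    have : (fun h : R => `|h|) @ 0^' --> (0:R).
      rewrite -[X in _ --> X](@normr0 _ R); apply: cvg_norm.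
      by apply: cvg_within_filter; exact: cvg_id.
    move=> nh; apply: (cvg_trans _ nh); apply: near_eq_cvg; near=> h => /=.
    rewrite mul0r subr0 addr0 mulr1 mulrA mulVf ?mul1r//.
    by near: h; exact: nbhs_dnbhs_neq.
  apply: DeriveDef; first by apply/cvg_ex; exists 0.
  by rewrite normr0 mulr0; exact: cvg_lim.
Unshelve. all: by end_near. Qed.

(** For [c < d], a nonnegative function of class C^1, positive exactly on
    [(c, d)]. *)
Definition hump c d x : R :=
  let y := (x - c) * (d - x) in y * `|y| + y ^+ 2.

Definition dhump c d x : R :=
  let y := (x - c) * (d - x) in (2 * `|y| + 2 * y) * (c + d - 2 * x).

(** As [n] grows, these functions increase to the indicator of [(c, d)]; the
    value is [n h / (1 + n h)] with [h] the hump. *)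
Definition bump c d (n : nat) x : R := 1 - (1 + n%:R * hump c d x)^-1.

Definition dbump c d (n : nat) x : R :=
  n%:R * dhump c d x * (1 + n%:R * hump c d x) ^- 2.

Lemma hump_ge0 c d x : 0 <= hump c d x.
Proof.
rewrite /hump /=; set y := (x - c) * (d - x).
have [y0|y0] := leP 0 y.
  by rewrite addr_ge0 ?sqr_ge0// mulr_ge0.
by rewrite ltr0_norm// mulrN expr2 addNr.
Qed.

Lemma hump_gt0 c d x : c < x < d -> 0 < hump c d x.
Proof.
move=> /andP[cx xd]; rewrite /hump/=; set y := (x - c) * (d - x).
have y0 : 0 < y by rewrite mulr_gt0// subr_gt0.
by rewrite gtr0_norm// addr_gt0 ?exprn_gt0// mulr_gt0.
Qed.

Lemma hump_out c d x : c < d -> ~ (c < x < d) -> hump c d x = 0.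
Proof.
move=> cd nx; rewrite /hump/=; set y := (x - c) * (d - x).
have y0 : y <= 0.
  have [xc|xc] := leP x c; first by rewrite mulr_le0_ge0; lra.
  have [xd|xd] := ltP x d; first by case: nx; rewrite xc xd.
  by rewrite mulr_ge0_le0; lra.
by rewrite ler0_norm// mulrN expr2 addNr.
Qed.

Lemma is_derive_hump c d x : is_derive x 1 (hump c d) (dhump c d x).
Proof.
pose q (x : R) := (x - c) * (d - x).
have dq : is_derive x 1 q (c + d - 2 * x).
  rewrite /q; apply: is_derive_eq => /=.
  rewrite /GRing.scale/=; ring.
have ds : is_derive (q x) 1 (fun y : R => y * `|y| + y ^+ 2)
    (2 * `|q x| + 2 * q x).
  apply: is_deriveD; first exact: is_derive_sqr_sign.
  apply: is_derive_eq; rewrite /GRing.scale/=; ring.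
rewrite (_ : hump c d = (fun y : R => y * `|y| + y ^+ 2) \o q)//.
by have := is_derive1_comp ds dq; rewrite /dhump.
Qed.

Lemma denominator_ge1 c d n x : 1 <= 1 + n%:R * hump c d x.
Proof. by rewrite lerDl mulr_ge0// hump_ge0. Qed.

Lemma is_derive_bump c d n x : is_derive x 1 (bump c d n) (dbump c d n x).
Proof.
have := is_derive_hump c d x => dh.
have den0 : 1 + n%:R * hump c d x != 0.
  by rewrite gt_eqF// (lt_le_trans _ (denominator_ge1 c d n x)).
have dd : is_derive x 1 (fun x => 1 + n%:R * hump c d x) (n%:R * dhump c d x).
  apply: is_derive_eq; rewrite /GRing.scale/=; ring.
have dv : is_derive x 1 (fun x => (1 + n%:R * hump c d x)^-1)
    (- (n%:R * dhump c d x * (1 + n%:R * hump c d x) ^- 2)).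
  apply: DeriveDef; first by apply: derivableV => //; exact: ex_derive.
  rewrite (@deriveV _ _ (fun x => 1 + n%:R * hump c d x))//.
  by rewrite derive_val /GRing.scale/= mulNr mulrC.
by rewrite /bump; apply: is_derive_eq; rewrite opprK add0r mul1r.
Qed.

Lemma continuous_dbump c d n : continuous (dbump c d n).
Proof.
have ch : continuous (hump c d).
  move=> x; apply: differentiable_continuous; apply/derivable1_diffP.
  by have [] := is_derive_hump c d x.
have cd : continuous (fun x : R => (x - c) * (d - x)).
  by move=> x; apply: cvgM; [apply: cvgB|apply: cvgB] => //; exact: cvg_cst.
move=> x; rewrite /dbump /dhump; apply: cvgM.
  apply: cvgMr; apply: cvgM.
    apply: cvgD; first by apply: cvgMr; apply: cvg_norm; exact: cd.
    by apply: cvgMr; exact: cd.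
  by apply: cvgB; [exact: cvg_cst|apply: cvgMr; exact: cvg_id].
apply: cvgV; first by rewrite expf_neq0// gt_eqF// (lt_le_trans _ (denominator_ge1 c d n x)).
under eq_fun do rewrite expr2; rewrite expr2.
by apply: cvgM; apply: cvgD; (try exact: cvg_cst); apply: cvgMr; exact: ch.
Qed.

Lemma bump_out c d n x : c < d -> ~ (c < x < d) -> bump c d n x = 0.
Proof.
by move=> cd /(hump_out cd) h0; rewrite /bump h0 mulr0 addr0 invr1 subrr.
Qed.

Lemma test_function_bump c d n : 0 < c -> c < d -> d < 1 ->
  test_function (bump c d n).
Proof.
move=> c0 cd d1.
have db x := is_derive_bump c d n x.
split; first by move=> x; exact: ex_derive.
- rewrite (_ : derive1 _ = dbump c d n); first exact: continuous_dbump.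
  by apply/funext => x; rewrite derive1E derive_val.
- exists c, d; split=> // x nx; apply: bump_out => //; apply: contra_not nx.
  by move=> /andP[cx xd]; rewrite !ltW.
Qed.

Lemma bump_itv01 c d n x : 0 <= bump c d n x <= 1.
Proof.
have := denominator_ge1 c d n x; set D := 1 + _ => D1.
have D0 : 0 < D by exact: lt_le_trans D1.
by rewrite /bump subr_ge0 gerBl invr_ge0 invf_le1// D1 ltW.
Qed.

Lemma bump_cvg c d x : c < x < d -> bump c d n x @[n --> \oo] --> (1 : R).
Proof.
move=> cxd; rewrite -[X in _ --> X]subr0; apply: cvgB; first exact: cvg_cst.
have h0 := hump_gt0 cxd.
apply/gtr0_cvgV0.
  by near=> n; rewrite (lt_le_trans _ (denominator_ge1 c d n x)).
apply/cvgryPge => A; near=> n.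
rewrite (@le_trans _ _ (n%:R * hump c d x))// ?lerDr//.
by rewrite -ler_pdivrMr//; near: n; exact: nbhs_infty_ger.
Unshelve. all: by end_near. Qed.

End Bumps.

Section WeakDerivative.
Context {R : realType}.
Local Notation mu := (@lebesgue_measure R).

Lemma locally_integrable_itv (h : R -> R) (a b : R) (b0 b1 : bool) :
  locally_integrable [set: R] h ->
  mu.-integrable [set` Interval (BSide b0 a) (BSide b1 b)] (EFin \o h).
Proof.
move=> [mh _ fh]; apply: (@integrableS _ _ _ mu `[a, b]%classic) => //.
- by apply: subset_itv; case: b0; case: b1; rewrite bnd_simp.
- apply/integrableP; split; first by apply/measurable_EFinP; exact: measurable_funTS.
  by apply: fh => //; exact: segment_compact.
Qed.

(** By Lebesgue differentiation [h] is almost everywhere the derivative of its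
    primitive, which is constant. *)
Lemma ae_eq0_primitive (h : R -> R) (a b : R) :
  locally_integrable [set: R] h ->
  (forall x, a < x < b -> \int[mu]_(t in `[a, x]) h t = 0) ->
  {ae mu, forall x, a < x < b -> h x = 0}.
Proof.
move=> lh h0; have hi y : mu.-integrable `[a, y] (EFin \o h).
  exact: locally_integrable_itv.
have := FTC1 hi lh; apply: ae_imply => x H /andP[ax xb].
have [|_ <-] := H; first by rewrite (@lte_fin R).
rewrite derive1E (@near_eq_derive _ R^o R^o _ (cst 0)) ?derive_cst//.
near=> y; apply: h0; apply/andP; split; near: y.
  exact: lt_nbhsr.
exact: lt_nbhsl.
Unshelve. all: by end_near. Qed.

Lemma Rintegral_bump (w : R -> R) c d n : 0 < c -> c < d -> d < 1 ->
  \int[mu]_(x in `]0, 1[) (w x * bump c d n x) =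
  \int[mu]_(x in `]c, d[) (w x * bump c d n x).
Proof.
move=> c0 cd d1.
rewrite (@eq_Rintegral _ _ _ mu `]0, 1[%classic
    ((fun x => w x * bump c d n x) \_ `]c, d[)).
  rewrite -Rintegral_mkcondr setIidr//.
  by apply: subset_itv; rewrite bnd_simp ltW.
move=> x _; rewrite patchE; case: ifPn => //; rewrite notin_setE/= in_itv/=.
by move=> /(bump_out n cd) ->; rewrite mulr0.
Qed.

Lemma measurable_bump c d n (D : set R) : measurable_fun D (bump c d n).
Proof.
apply: measurable_funTS; apply: continuous_measurable_fun => x.
apply: differentiable_continuous; apply/derivable1_diffP.
by have [] := is_derive_bump c d n x.
Qed.

(** Testing the difference of two weak derivatives against bumps that converge
    to the indicator of [(c, d)] shows that its integral over [(c, d)] vanishes;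
    an exhaustion of [(0, 1)] is needed because the weak derivatives are only
    locally integrable. *)
Lemma weak_derivative_unique (u w1 w2 : R -> R) :
  is_weak_derivative u w1 -> is_weak_derivative u w2 ->
  {ae mu, forall x, 0 < x < 1 -> w1 x = w2 x}.
Proof.
move=> [lw1 dw1] [lw2 dw2].
have lsub w c d b0 b1 : locally_integrable `]0, 1[ w -> 0 < c -> d < 1 ->
    mu.-integrable [set` Interval (BSide b0 c) (BSide b1 d)] (EFin \o w).
  move=> [mw _ fw] c0 d1.
  have sub : `[c, d]%classic `<=` `]0, 1[%classic.
    by apply: subset_itv; rewrite bnd_simp.
  apply: (@integrableS _ _ _ mu `[c, d]%classic) => //.
    by apply: subset_itv; case: b0; case: b1; rewrite bnd_simp.
  apply/integrableP; split.
    by apply/measurable_EFinP; exact: measurable_funS mw.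
  by apply: fw => //; exact: segment_compact.
have bumpint w c d n : locally_integrable `]0, 1[ w -> 0 < c -> d < 1 ->
    mu.-integrable `]c, d[ (EFin \o (fun x => w x * bump c d n x)).
  move=> lw c0 d1; have wi := lsub w c d false true lw c0 d1.
  apply: (le_integrable _ _ _ wi) => //.
    apply/measurable_EFinP; apply: measurable_funM; last exact: measurable_bump.
    by have /measurable_EFinP := measurable_int _ wi.
  move=> x _ /=; rewrite lee_fin normrM ler_piMr//.
  by have /andP[b0 b1] := bump_itv01 c d n x; rewrite ger0_norm.
pose h x := w1 x - w2 x.
have lh : locally_integrable `]0, 1[ h by exact: locally_integrableB.
have h0 c d : 0 < c -> c < d -> d < 1 -> \int[mu]_(x in `]c, d[) h x = 0.
  move=> c0 cd d1.
  have hn n : (\int[mu]_(x in `]c, d[) (h x * bump c d n x)%:E = 0)%E.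
    rewrite -[LHS]fineK; last by apply: integrable_fin_num => //; exact: bumpint.
    congr EFin; rewrite -/(Rintegral mu `]c, d[ (fun x => h x * bump c d n x)).
    under eq_Rintegral do rewrite mulrBl.
    rewrite RintegralB//; [|exact: bumpint|exact: bumpint].
    rewrite -!Rintegral_bump//; apply/eqP; rewrite subr_eq0 -eqr_opp.
    have tb := test_function_bump n c0 cd d1.
    by rewrite -dw1// -dw2.
  have hi := lsub h c d false true lh c0 d1.
  have mh := measurable_int _ hi.
  have [||||||_ _ H] := @dominated_convergence _ _ _ mu `]c, d[%classic _
    (fun n x => (h x * bump c d n x)%:E) (EFin \o h) (fun x => `|h x|%:E).
  - by [].
  - move=> n; apply/measurable_EFinP; apply: measurable_funM; last exact: measurable_bump.
    exact/measurable_EFinP.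
  - by [].
  - apply: aeW => x /=; rewrite in_itv/= => xcd.
    apply/fine_cvgP; split; first by apply: nearW.
    rewrite -[X in _ --> X]mulr1; apply: cvgMr.
    exact: bump_cvg.
  - apply/integrable_norm => //.
  - apply: aeW => x n _ /=; rewrite lee_fin normrM ler_piMr//.
    by have /andP[b0 b1] := bump_itv01 c d n x; rewrite ger0_norm.
  move: H; set I := (X in X @ \oo --> _); have -> : I = (fun=> 0%E).
    by apply/funext => n; rewrite /I/= hn.
  by move/cvg_lim => Ih; rewrite /Rintegral -Ih ?lim_cst.
(* Exhaust (0, 1) by the intervals [[1 / (n + 1), 1 - 1 / (n + 1)]]. *)
pose an n : R := n.+1%:R^-1.
have an0 n : 0 < an n by rewrite invr_gt0.
have step n : {ae mu, forall x, an n < x < 1 - an n -> h x = 0}.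
  have hi : mu.-integrable `[an n, 1 - an n] (EFin \o h).
    by apply: lsub => //; rewrite gtrBl.
  have lhn := integrable_locally_restrict (measurable_itv _) hi.
  have hn0 x : an n < x < 1 - an n ->
      \int[mu]_(t in `[an n, x]) (h \_ `[an n, 1 - an n]) t = 0.
    move=> /andP[ax xb]; rewrite -(h0 (an n) x)//; last first.
      by rewrite (lt_trans xb)// gtrBl.
    have sub : `[an n, x]%classic `<=` `[an n, 1 - an n]%classic.
      by apply: subset_itv; rewrite bnd_simp// ltW.
    transitivity (\int[mu]_(t in `[an n, x]) h t).
      by apply: eq_Rintegral => t /set_mem tx; rewrite patchE mem_set//; exact: sub.
    rewrite /Rintegral integral_itv_bndoo//.
    have := measurable_int _ hi; apply: measurable_funS => //.
    by apply: subset_itv; rewrite bnd_simp// ltW.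
  apply: (ae_imply _ (ae_eq0_primitive lhn hn0)) => x hx xn.
  move: (hx xn); rewrite patchE mem_set//= in_itv/=.
  by move/andP: xn => [? ?]; rewrite !ltW.
have := ae_foralln step; apply: ae_imply => x hx /andP[x0 x1].
have m0 : 0 < Num.min x (1 - x) by rewrite lt_min x0 subr_gt0.
have [n _ nm] := near_infty_natSinv_lt (PosNum m0).
have := nm n (leqnn n); rewrite /= lt_min => /andP[nx n1].
apply/eqP; rewrite -subr_eq0; apply/eqP/(hx n).
by rewrite nx/= ltrBrDl -ltrBrDr.
Qed.

(** Fubini's theorem on the triangle [s <= x]: integrating first in [x] turns
    [phi'] into [- phi s], because [phi] vanishes near 1. *)
Lemma weak_derivative_primitive (u w : R -> R) :
  mu.-integrable `]0, 1[ (EFin \o w) ->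
  (forall x, 0 < x < 1 -> u x = \int[mu]_(s in `[0, x]) w s) ->
  is_weak_derivative u w.
Proof.
move=> wi uw; split.
  by apply: open_integrable_locally => //; exact: interval_open.
move=> phi [dphi cdphi [a [b [a0 b1 phi0]]]].
pose D : set R := `]0, 1[%classic.
have mD : measurable D by exact: measurable_itv.
pose W := w \_ D; pose P := (derive1 phi) \_ D.
pose K (z : R * R) : R := if z.1 <= z.2 then W z.1 * P z.2 else 0.
have iW : mu.-integrable [set: R] (EFin \o W).
  exact/(integrable_patch _ mD).
have mW : measurable_fun [set: R] W by exact: integrable_measurable_fun iW.
have iphi c d : mu.-integrable `[c, d] (EFin \o derive1 phi).
  apply: continuous_compact_integrable; first exact: segment_compact.
  exact: continuous_subspaceT.
have iP : mu.-integrable [set: R] (EFin \o P).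
  apply/(integrable_patch _ mD).
  apply: integrableS (iphi 0 1) => //.
  by apply: subset_itv; rewrite bnd_simp.
have mP : measurable_fun [set: R] P by exact: integrable_measurable_fun iP.
have mK : measurable_fun [set: R * R] K.
  apply: measurable_fun_ifT.
  - by apply: measurable_fun_ler; [exact: measurable_fst|exact: measurable_snd].
  - apply: measurable_funM.
      by apply: (measurableT_comp mW); exact: measurable_fst.
    by apply: (measurableT_comp mP); exact: measurable_snd.
  - exact: measurable_cst.
have mKs s : measurable_fun [set: R] (fun x => K (s, x)).
  apply: measurable_fun_ifT; last exact: measurable_cst.
    by apply: measurable_fun_ler; [exact: measurable_cst|exact: measurable_id].
  by apply: measurable_funM; [rewrite /=; exact: measurable_cst|exact: mP].
have mEK : measurable_fun [set: R * R] (EFin \o K) by exact/measurable_EFinP.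
have iK : (mu \x mu)%E.-integrable [set: R * R] (EFin \o K).
  apply/(integrable12ltyP mu mu mEK).
  have [mEP foP] := integrableP _ _ _ iP.
  have [mEW foW] := integrableP _ _ _ iW.
  pose C := (\int[mu]_x `|(EFin \o P) x|)%E.
  have C0 : (0 <= C)%E by exact: integral_ge0.
  apply: (@le_lt_trans _ _ (\int[mu]_s (`|(EFin \o W) s| * C))%E).
    apply: ge0_le_integral => //.
    - by move=> s _; exact: integral_ge0.
    - apply: (@measurable_fun_fubini_tonelli_F _ _ _ _ _ mu (abse \o (EFin \o K))).
        exact: measurableT_comp.
      by move=> ?; exact: abse_ge0.
    - apply: emeasurable_funM; last exact: measurable_cst.
      exact: measurableT_comp.
    - move=> s _; rewrite -ge0_integralZl//; last exact: measurableT_comp.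
      apply: ge0_le_integral => //.
      + by apply: measurableT_comp => //; apply/measurable_EFinP; exact: mKs.
      + by apply: measurable_funeM; exact: measurableT_comp.
      + move=> x _; rewrite /= /K/=; case: ifPn => _; first by rewrite normrM EFinM.
        by rewrite normr0 mule_ge0.
  rewrite ge0_integralZr//; last exact: measurableT_comp.
  by rewrite lte_mul_pinfty// ?integral_ge0// ge0_fin_numE// integral_ge0.
have subx x : D x -> `]0, x]%classic `<=` D.
  by rewrite /D/= in_itv/= => /andP[_ x1]; apply: subset_itv; rewrite bnd_simp.
(* The inner integral in [s] gives back [u x * phi' x], and the inner integral
   in [x] gives [- w s * phi s]. *)
have primW x : (\int[mu]_s (EFin \o K) (s, x) =
    (((fun x => u x * derive1 phi x) \_ D) x)%:E)%E.
  rewrite patchE; case: ifPn => [/set_mem xD|xD]; last first.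
    have K0 s : K (s, x) = 0.
      by rewrite /K/= /P patchE (negbTE xD) mulr0; case: ifP.
    transitivity (0%E : \bar R); last by [].
    by apply: integral0_eq => s _; rewrite -[LHS]/((K (s, x))%:E) K0.
  have ix : mu.-integrable `]0, x] (EFin \o w).
    by apply: integrableS wi => //; exact: subx.
  transitivity (\int[mu]_s ((derive1 phi x)%:E * (EFin \o (w \_ (`]0%R, x]%classic : set R))) s))%E.
    apply: eq_integral => s _ /=; rewrite -EFinM /K/=; congr EFin.
    rewrite /P patchE (mem_set xD) patchE.
    have [/set_mem sA|/negP sA] := boolP (s \in (`]0%R, x]%classic : set R)).
      have := sA; rewrite /= in_itv/= => /andP[s0 sx]; rewrite sx mulrC.
      by rewrite /W patchE mem_set//; exact: (subx x xD).
    rewrite mulr0; case: ifPn => // sx.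
    rewrite /W patchE memNset ?mul0r// /D/= in_itv/= => /andP[s0 _].
    by apply: sA; rewrite inE/= in_itv/= s0 sx.
  rewrite integralZl//; last by apply/(integrable_patch _ (measurable_itv _)).
  rewrite -restrict_EFin -integral_mkcond uw; last by move: xD; rewrite /D/= in_itv.
  rewrite -Rintegral_itv_obnd_cbnd// EFinM muleC; congr (_ * _)%E.
  by rewrite /Rintegral fineK//; exact: integrable_fin_num.
have primP s : (\int[mu]_x (EFin \o K) (s, x) =
    (((fun s => - (w s * phi s)) \_ D) s)%:E)%E.
  rewrite patchE; case: ifPn => [/set_mem sD|sD]; last first.
    have K0 x : K (s, x) = 0.
      by rewrite /K/= /W patchE (negbTE sD) mul0r; case: ifP.
    transitivity (0%E : \bar R); last by [].
    by apply: integral0_eq => x _; rewrite -[LHS]/((K (s, x))%:E) K0.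
  have := sD; rewrite /D/= in_itv/= => /andP[s0 s1].
  transitivity (\int[mu]_x ((w s)%:E * (EFin \o (derive1 phi \_ (`[s, 1%R[%classic : set R))) x))%E.
    apply: eq_integral => x _ /=; rewrite -EFinM /K/=; congr EFin.
    rewrite /W patchE (mem_set sD) patchE.
    have [/set_mem xA|/negP xA] := boolP (x \in (`[s, 1%R[%classic : set R)).
      have := xA; rewrite /= in_itv/= => /andP[sx x1]; rewrite sx.
      by rewrite /P patchE mem_set// /D/= in_itv/= (lt_le_trans s0).
    rewrite mulr0; case: ifPn => // sx.
    rewrite /P patchE memNset ?mulr0// /D/= in_itv/= => /andP[_ x1].
    by apply: xA; rewrite inE/= in_itv/= sx x1.
  have is1 : mu.-integrable `[s, 1[ (EFin \o derive1 phi).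
    by apply: integrableS (iphi s 1) => //; apply: subset_itv; rewrite bnd_simp.
  rewrite integralZl//; last by apply/(integrable_patch _ (measurable_itv _)).
  rewrite -restrict_EFin -integral_mkcond integral_itv_bndo_bndc; last exact: measurable_int is1.
  have cphi : continuous phi.
    move=> y; apply: differentiable_continuous; apply/derivable1_diffP; exact: dphi.
  have -> : (\int[mu]_(x in `[s, 1%R]) (derive1 phi x)%:E =
      (phi 1)%:E - (phi s)%:E)%E.
    apply: (continuous_FTC2 s1); first exact: continuous_subspaceT; last first.
      by move=> y _.
    split; first by move=> y _; exact: dphi.
      by apply: cvg_at_right_filter; exact: cphi.
    by apply: cvg_at_left_filter; exact: cphi.
  rewrite [phi 1]phi0 ?sub0e -?EFinN -?EFinM ?mulrN//.
  by move=> /andP[_]; rewrite leNgt b1.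
have iG : mu.-integrable [set: R] (EFin \o ((fun s => - (w s * phi s)) \_ D)).
  by have := integrable_fubini_F iK; congr (mu.-integrable _ _); apply/funext.
rewrite Rintegral_mkcond [RHS](_ : _ = (-1) * \int[mu]_(x in D) (w x * phi x)); last first.
  by rewrite mulN1r.
rewrite [in RHS]Rintegral_mkcond -RintegralZl//; last first.
  have := integrableN iG; congr (mu.-integrable _ _); apply/funext => s /=.
  rewrite /= !patchE; congr EFin.
  by case: ifP => _; [rewrite opprK|exact: oppr0].
rewrite /Rintegral; congr fine.
transitivity (\int[mu]_x \int[mu]_s (EFin \o K) (s, x))%E.
  by apply: eq_integral => x _; rewrite primW.
rewrite -(Fubini iK); apply: eq_integral => s _; rewrite primP !patchE.
congr EFin.
by case: ifP => _; [rewrite mulN1r|exact/esym/mulr0].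
Qed.

Lemma weak_derivativeP (u w : R -> R) : is_weak_derivative u w ->
  measurable_fun (`]0, 1[%classic : set R) (weak_derivative u) /\
  {ae mu, forall x, 0 < x < 1 -> weak_derivative u x = w x}.
Proof.
move=> uw; have du : is_weak_derivative u (weak_derivative u).
  by rewrite /weak_derivative; case: xgetP => [v -> //|/(_ w)].
by split; [have [[]] := du|exact: weak_derivative_unique uw].
Qed.

End WeakDerivative.

(** * Local integrability and primitives *)

Section LocalIntegrability.
Context {R : realType}.
Local Notation mu := (@lebesgue_measure R).

Lemma lebesgue_measure_setT_gt0 : (0 < mu [set: R])%E.
Proof.
apply: (@lt_le_trans _ _ (mu `]0%R, 1%R[)).
  by rewrite lebesgue_measure_itv/= lte_fin ltr01 oppr0 adde0 lte_fin.
apply: le_measure; last by [].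
  by rewrite inE; exact: measurable_itv.
by rewrite inE; exact: measurableT.
Qed.

Lemma integrable_cst_itv (M a b : R) : mu.-integrable `]a, b[ (cst M%:E).
Proof.
apply/integrableP; split; first exact: measurable_cst.
rewrite (_ : (fun x => `|cst M%:E x|)%E = cst `|M|%:E)// integral_cst; last exact: measurable_itv.
rewrite -[X in (_ * X)%E]/(mu `]a, b[%classic) lebesgue_measure_itv/=.
case: ifP => _; last by rewrite mule0.
by rewrite -EFinD -EFinM ltry.
Qed.

Lemma ae_itv_witness (P : R -> Prop) (a b : R) : a < b ->
  {ae mu, forall x, P x} -> exists2 x, a < x < b & P x.
Proof.
move=> ab [N [mN N0 PN]]; apply: contrapT => nP.
have sub : `]a, b[%classic `<=` N.
  move=> x /=; rewrite in_itv/= => xab; apply: PN => Px; apply: nP.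
  by exists x.
have : (mu `]a, b[ <= mu N)%E.
  by apply: le_measure => //; rewrite inE//; exact: measurable_itv.
rewrite N0 lebesgue_measure_itv/= lte_fin ab -EFinD lee_fin leNgt subr_gt0.
by rewrite ab.
Qed.

Lemma in_Lp_measurable (p : \bar R) (a b : R) (f : R -> R) :
  in_Lp p a b f -> measurable_fun (`]a, b[%classic : set R) f.
Proof.
move=> /sub_Lfun_mfun /set_mem /= mf.
by apply/(measurable_restrictT _ (measurable_itv _)).
Qed.

Lemma in_Loo_bounded (a b : R) (f : R -> R) : in_Lp +oo%E a b f ->
  exists2 M : R, 0 <= M & {ae mu, forall x, a < x < b -> `|f x| <= M}.
Proof.
move=> /sub_Lfun_finLfun /set_mem /=; rewrite /finite_norm unlock /=.
rewrite lebesgue_measure_setT_gt0 => fin.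
have := ess_sup_ge mu (abse \o (EFin \o (f \_ `]a, b[))).
case: (ess_sup _ _) fin => [M _|//|_] H; last first.
  by exists 0 => //; apply: ae_imply H.
exists (Num.max 0 M); first by rewrite le_max lexx.
apply: ae_imply H => x /=; rewrite lee_fin => H xab.
by move: H; rewrite patchE mem_set// le_max => ->; rewrite orbT.
Qed.

Lemma in_Lp_powR_integrable (q a b : R) (f : R -> R) : 1 <= q ->
  in_Lp q%:E a b f -> mu.-integrable `]a, b[ (fun x => (`|f x| `^ q)%:E).
Proof.
move=> q1 fL.
have fi := Lfun_integrable q1 fL.
have : mu.-integrable `]a, b[ (fun x => (`|(f \_ `]a, b[) x| `^ q)%:E).
  by apply: integrableS fi.
apply: eq_integrable => // x /set_mem xab.
by rewrite patchE mem_set.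
Qed.

(** On a bounded interval [|f| <= 1 + |f|^q]. *)
Lemma in_Lp_integrable (p : \bar R) (a b : R) (f : R -> R) : (1 <= p)%E ->
  in_Lp p a b f -> mu.-integrable `]a, b[ (EFin \o f).
Proof.
have c1 (M : R) := integrable_cst_itv M a b.
case: p => [q q1 fL|_ fL|//].
- rewrite lee_fin in q1.
  have pi := in_Lp_powR_integrable q1 fL.
  have : mu.-integrable `]a, b[ (cst 1%:E \+ (fun x => (`|f x| `^ q)%:E))%E.
    by apply: integrableD => //; exact: c1.
  apply: le_integrable => //.
    by apply/measurable_EFinP; exact: in_Lp_measurable fL.
  move=> x _ /=; rewrite lee_fin [leRHS]ger0_norm ?addr_ge0 ?powR_ge0//.
  have [f1|f1] := leP `|f x| 1; first by rewrite (le_trans f1)// lerDl powR_ge0.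
  by rewrite -[leLHS]add0r lerD// -[leLHS]powRr1// ler_powR// ltW.
- have [M M0 fM] := in_Loo_bounded fL.
  have mf := in_Lp_measurable fL.
  apply/integrableP; split; first exact/measurable_EFinP.
  apply: (@le_lt_trans _ _ (\int[mu]_(x in `]a, b[) (cst M%:E) x)%E).
    apply: ae_ge0_le_integral => //.
    by do 2 apply: measurableT_comp => //; exact/measurable_EFinP.
  by have /integrable_lty := c1 M; apply.
Qed.

Lemma in_Lp_of_bounded (p : \bar R) (a b M : R) (f : R -> R) :
  (1 <= p)%E -> measurable_fun (`]a, b[%classic : set R) f ->
  (forall x, a < x < b -> `|f x| <= M) -> in_Lp p a b f.
Proof.
move=> p1 mf fM; rewrite /in_Lp inE; apply/andP; split; rewrite inE/=.
  by apply/(measurable_restrictT _ (measurable_itv _)).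
have c1 (M : R) := integrable_cst_itv M a b.
have mF : measurable_fun [set: R] (f \_ `]a, b[).
  by apply/(measurable_restrictT _ (measurable_itv _)).
rewrite /finite_norm unlock; case: p p1 => [q|_|//] /=.
- rewrite lee_fin => q1; apply: poweR_lty.
  have q0 : 0 < q by exact: lt_le_trans q1.
  apply: (@le_lt_trans _ _ (\int[mu]_(x in `]a, b[) (cst (`|M| `^ q)%:E) x)%E).
    rewrite [leRHS]integral_mkcond; apply: ge0_le_integral => //.
    + apply: measurableT_comp => //; apply: (measurableT_comp (measurable_powR q)).
      exact: measurableT_comp.
    + apply/(measurable_restrictT _ (measurable_itv _)); exact: measurable_cst.
    + move=> x _; rewrite !patchE; case: ifPn => [/set_mem xab|_]; last first.
        by rewrite normr0 powR0 ?gt_eqF.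
      rewrite lee_fin ge0_ler_powR ?nnegrE//; first exact: ltW.
      by rewrite (le_trans _ (ler_norm M))// fM//; move: xab; rewrite /= in_itv.
  by have /integrable_lty := c1 (`|M| `^ q); apply.
- rewrite lebesgue_measure_setT_gt0.
  apply: (@le_lt_trans _ _ `|M|%:E); last exact: ltry.
  apply/ess_supP; apply: aeW => x /=; rewrite lee_fin patchE.
  case: ifPn => [/set_mem xab|_]; last by rewrite normr0.
  by rewrite (le_trans _ (ler_norm M))// fM//; move: xab; rewrite /= in_itv.
Qed.

Lemma locally_integrable_of_itv (h : R -> R) :
  measurable_fun [set: R] h ->
  (forall a b, mu.-integrable `[a, b] (EFin \o h)) ->
  locally_integrable [set: R] h.
Proof.
move=> mh hi; split=> //; first exact: openT.
move=> K _ cK; have [M [_ KM]] := compact_bounded cK.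
have mK : measurable K by exact: compact_measurable.
have /integrableP[_ hfin] := hi (- (`|M| + 1)) (`|M| + 1).
apply: le_lt_trans hfin; apply: ge0_subset_integral => //.
  by apply: measurable_funTS; do 2 apply: measurableT_comp => //.
move=> x /(KM (`|M| + 1)) /=; rewrite in_itv/= -ler_norml; apply.
by rewrite (le_lt_trans (ler_norm M))// ltrDl.
Qed.

Lemma locally_integrable_shift (G : R -> R) (t : R) :
  locally_integrable [set: R] G -> locally_integrable [set: R] (fun s => G (t + s)).
Proof.
move=> lG; have [mG _ _] := lG.
have pS := measure_preserving_shift t.
apply: locally_integrable_of_itv; first by apply: measurableT_comp mG pS.1.
move=> a b.
have := integrable_measure_preserving pS (measurable_itv _) (f := EFin \o G) _
  (locally_integrable_itv (t + a) (t + b) true false lG).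
rewrite (_ : _ @^-1` _ = `[a, b]%classic); first by apply; exact/measurable_EFinP.
by apply/seteqP; split=> s /=; rewrite !in_itv/= !lerD2l.
Qed.

Lemma locally_integrable_reflection (G : R -> R) (t : R) :
  locally_integrable [set: R] G -> locally_integrable [set: R] (fun s => G (t - s)).
Proof.
move=> lG; have [mG _ _] := lG.
have pR := measure_preserving_reflection t.
apply: locally_integrable_of_itv; first by apply: measurableT_comp mG pR.1.
move=> a b.
have := integrable_measure_preserving pR (measurable_itv _) (f := EFin \o G) _
  (locally_integrable_itv (t - b) (t - a) true false lG).
rewrite (_ : _ @^-1` _ = `[a, b]%classic); first by apply; exact/measurable_EFinP.
by apply/seteqP; split=> s /=; rewrite !in_itv/= !lerD2l !lerN2 andbC.
Qed.

(** Extending by zero makes the function locally integrable on the whole line,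
    so that the left endpoint plays no special role afterwards. *)
Lemma in_Lploc_locally_integrable (p : \bar R) (a : R) (f : R -> R) :
  (1 <= p)%E -> in_Lploc p a f ->
  locally_integrable [set: R] (f \_ `]a, +oo[).
Proof.
move=> p1 fL.
have E : (`]a, +oo[%classic : set R) = \bigcup_n `]a, a + n.+1%:R[%classic.
  apply/seteqP; split=> x /=; rewrite in_itv/= ?andbT.
    move=> ax; exists (Num.truncn (x - a)) => //=; rewrite in_itv/= ax -ltrBlDl.
    by rewrite truncnS_gt.
  by move=> [n _] /=; rewrite in_itv/= => /andP[].
have aS n : a < a + n.+1%:R by rewrite ltrDl.
have mf : measurable_fun [set: R] (f \_ `]a, +oo[).
  apply/(measurable_restrictT _ (measurable_itv _)); rewrite E.
  apply/measurable_fun_bigcup => [n|n]; first exact: measurable_itv.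
  exact: in_Lp_measurable (fL _ (aS n)).
apply: locally_integrable_of_itv => // u v.
pose T := Num.max (a + 1) (v + 1).
have aT : a < T by rewrite lt_max ltrDl ltr01.
have vT : v < T by rewrite lt_max [v < v + 1]ltrDl ltr01 orbT.
apply/(integrable_patch _ (measurable_itv _)).
have mI : measurable (`[u, v] `&` `]a, +oo[ : set R).
  by apply: measurableI; exact: measurable_itv.
have : mu.-integrable (`[u, v] `&` `]a, +oo[) (EFin \o f).
  apply: integrableS (in_Lp_integrable p1 (fL _ aT)) => //.
  move=> x [/=]; rewrite !in_itv/= andbT => /andP[_ xv] ->/=.
  exact: le_lt_trans vT.
move/(integrable_patch _ mI).
congr (mu.-integrable _ (EFin \o _)); apply/funext => x.
by rewrite !patchE in_setI; case: (x \in `[u, v]%classic).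
Qed.

Lemma Rintegral_itv_oc_split (h : R -> R) (a c b : R) :
  locally_integrable [set: R] h -> a <= c -> c <= b ->
  \int[mu]_(x in `]a, b]) h x =
  \int[mu]_(x in `]a, c]) h x + \int[mu]_(x in `]c, b]) h x.
Proof.
move=> lh ac cb.
have hi : mu.-integrable [set` Interval (BRight a) (BRight b)] (EFin \o h).
  exact: locally_integrable_itv.
rewrite -(Rintegral_itvB hi (x := c)) ?bnd_simp//.
by rewrite addrC subrK.
Qed.

Lemma Rintegral_itv_cc_oc (h : R -> R) (a b : R) :
  locally_integrable [set: R] h ->
  \int[mu]_(x in `[a, b]) h x = \int[mu]_(x in `]a, b]) h x.
Proof.
by move=> lh; rewrite -Rintegral_itv_obnd_cbnd//; exact: locally_integrable_itv.
Qed.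

(** Chasles' relation; the orientation matters as soon as [a] is negative. *)
Lemma oriented_integralB (h : R -> R) (a b : R) :
  locally_integrable [set: R] h -> a <= b ->
  oriented_integral 0 b h - oriented_integral 0 a h =
  \int[mu]_(x in `]a, b]) h x.
Proof.
move=> lh ab; rewrite /oriented_integral.
have [a0|a0] := leP 0 a.
  rewrite (le_trans a0 ab) !Rintegral_itv_cc_oc//.
  by rewrite (Rintegral_itv_oc_split lh a0 ab) addrC addKr.
have [b0|b0] := leP 0 b; rewrite !Rintegral_itv_cc_oc// opprK.
  by rewrite (Rintegral_itv_oc_split lh (ltW a0) b0) addrC.
by rewrite (Rintegral_itv_oc_split lh ab (ltW b0)) addrC -addrA subrr addr0.
Qed.

Lemma oriented_integral_patch (f : R -> R) (a T : R) :
  locally_integrable [set: R] (f \_ `]a, +oo[) -> a <= 0 -> a <= T ->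
  oriented_integral 0 T f = oriented_integral 0 T (f \_ `]a, +oo[).
Proof.
move=> lf a0 aT.
have key c d : a <= c ->
    \int[mu]_(x in `[c, d]) f x = \int[mu]_(x in `[c, d]) (f \_ `]a, +oo[) x.
  move=> ac; rewrite [RHS]Rintegral_itv_cc_oc//.
  have E : {in (`]c, d]%classic : set R), f =1 f \_ `]a, +oo[}.
    move=> x /set_mem /=; rewrite in_itv/= => /andP[cx _].
    by rewrite patchE mem_set//= in_itv/= andbT (le_lt_trans ac).
  have fi : mu.-integrable `]c, d] (EFin \o f).
    have := locally_integrable_itv c d false false lf.
    by apply: eq_integrable => //; move=> x xcd /=; rewrite E.
  rewrite -[LHS]Rintegral_itv_obnd_cbnd//; exact: eq_Rintegral.
by rewrite /oriented_integral; case: ifP => _; rewrite key.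
Qed.

Lemma Rintegral_symmetric_window (G : R -> R) (t x : R) :
  locally_integrable [set: R] G -> 0 <= x ->
  \int[mu]_(s in `]t - x, t + x]) G s =
  \int[mu]_(s in `[0, x]) (G (t + s) + G (t - s)).
Proof.
move=> lG x0; have [mG _ _] := lG.
have pS := measure_preserving_shift t.
have pR := measure_preserving_reflection t.
have ES : (fun s => t + s) @^-1` `[t, t + x] = `[0, x]%classic.
  by apply/seteqP; split=> s /=; rewrite !in_itv/=; lra.
have ER : (fun s => t - s) @^-1` `[t - x, t] = `[0, x]%classic.
  by apply/seteqP; split=> s /=; rewrite !in_itv/=; lra.
have mEG : measurable_fun [set: R] (EFin \o G) by exact/measurable_EFinP.
have iS := locally_integrable_itv t (t + x) true false lG.
have iR := locally_integrable_itv (t - x) t true false lG.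
have := integrable_measure_preserving pS (measurable_itv _) mEG iS.
have := integrable_measure_preserving pR (measurable_itv _) mEG iR.
rewrite ES ER => iR' iS'.
rewrite RintegralD//.
rewrite -ES -(Rintegral_measure_preserving pS (measurable_itv _) mG iS).
rewrite ES -ER -(Rintegral_measure_preserving pR (measurable_itv _) mG iR).
rewrite !Rintegral_itv_cc_oc// [RHS]addrC.
by apply: Rintegral_itv_oc_split => //; rewrite ?gerBl ?lerDl.
Qed.

End LocalIntegrability.

(** * Solutions as outgoing profiles *)

Section SetValuedMap.
Context {R : realType}.
Variables (Sigma : set (R * R)) (S : R -> set R).
Hypothesis hS : graph_of S = rotation @` Sigma.

Lemma sqrt2_sqr : (Num.sqrt 2)^-1 * (Num.sqrt 2)^-1 = 2^-1 :> R.
Proof. by rewrite -invfM -expr2 sqr_sqrtr. Qed.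

(** The rotation by [- pi / 4] is inverted explicitly. *)
Lemma map_of_rotationP x y :
  S x y <-> Sigma ((x - y) / Num.sqrt 2, (x + y) / Num.sqrt 2).
Proof.
have E : S x y <-> (rotation @` Sigma) (x, y) by rewrite -hS.
have c2 := sqrt2_sqr; set c := (Num.sqrt 2)^-1 in c2 *.
rewrite E; split=> [[[a b] ab]|xy].
  rewrite /rotation/= -/c => -[<- <-].
  rewrite (_ : (_ - _) * c = 2 * (c * c) * a); last by ring.
  rewrite (_ : (_ + _) * c = 2 * (c * c) * b); last by ring.
  by rewrite c2 divff// !mul1r.
exists ((x - y) * c, (x + y) * c) => //.
rewrite /rotation/= -/c; congr (_, _).
  rewrite [LHS](_ : _ = 2 * (c * c) * x); last by ring.
  by rewrite c2 divff// mul1r.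
rewrite [LHS](_ : _ = 2 * (c * c) * y); last by ring.
by rewrite c2 divff// mul1r.
Qed.

Lemma map_of_damping0 : damping_set Sigma -> S 0 0.
Proof.
by move=> [S00 _ _]; apply/map_of_rotationP; rewrite subrr addr0 mul0r.
Qed.

(** The rotated point [q] of [xi] satisfies [q.1 ^ 2 - q.2 ^ 2 = 2 xi.1 xi.2],
    which is nonnegative on the damping set. *)
Lemma map_of_damping_le x y : damping_set Sigma -> S x y -> `|y| <= `|x|.
Proof.
move=> [_ pos _] /map_of_rotationP /pos.
rewrite mulrACA sqrt2_sqr pmulr_lge0 ?invr_gt0// => h.
by rewrite -[_ <= _]ler_sqr ?nnegrE// !real_normK ?num_real//; nra.
Qed.

End SetValuedMap.

Section SolutionStructure.
Context {R : realType}.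
Local Notation mu := (@lebesgue_measure R).
Variables (Sigma : set (R * R)) (S : R -> set R) (p : \bar R).
Variables (z0 z1 : R -> R) (z : R -> R -> R) (f g : R -> R).
Hypothesis hS : graph_of S = rotation @` Sigma.
Hypothesis hp : (1 <= p)%E.
Hypothesis hsol : solution Sigma p z0 z1 z f g.

(** The profile of the wave that moves away from [x = 0], extended by zero; it
    carries all the information on the solution. *)
Definition outgoing (g : R -> R) : R -> R := g \_ `]-1, +oo[.
Local Notation G := (outgoing g).
Let F := f \_ `]0, +oo[.

Lemma outgoingE (s : R) : -1 < s -> G s = g s.
Proof. by move=> s1; rewrite /outgoing patchE mem_set//= in_itv/= s1. Qed.

Lemma outgoing_locally_integrable : locally_integrable [set: R] G.
Proof. by case: hsol => _ lg _ _ _; exact: in_Lploc_locally_integrable lg. Qed.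

Let lF : locally_integrable [set: R] F.
Proof. by case: hsol => lf _ _ _ _; exact: in_Lploc_locally_integrable lf. Qed.

Let FE (s : R) : 0 < s -> F s = f s.
Proof. by move=> s0; rewrite /F patchE mem_set//= in_itv/= s0. Qed.

Let c : R := (Num.sqrt 2)^-1.
Let c0 : 0 < c. Proof. by rewrite invr_gt0 sqrtr_gt0. Qed.

Let zE t x : 0 <= t -> 0 <= x <= 1 ->
  z t x = c * (oriented_integral 0 (t + x) F + oriented_integral 0 (t - x) G).
Proof.
move=> t0 /andP[x0 x1]; case: hsol => _ _ zE _ _.
rewrite zE ?x0// -mulrDr; congr (_ * (_ + _)).
  by apply: oriented_integral_patch => //; rewrite addr_ge0.
apply: oriented_integral_patch => //; first exact: outgoing_locally_integrable.
by rewrite (@le_trans _ _ (- x)) ?lerN2// lerDr.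
Qed.

(** This is [z(t, 0) = 0], first for almost every [t], then for every [t] since
    both primitives are continuous. *)
Lemma boundary_primitive t : 0 <= t ->
  oriented_integral 0 t F + oriented_integral 0 t G = 0.
Proof.
pose h s := F s + G s.
have lG := outgoing_locally_integrable.
have lh : locally_integrable [set: R] h by exact: locally_integrableD.
have prim u : 0 <= u -> oriented_integral 0 u F + oriented_integral 0 u G =
    \int[mu]_(s in `[0, u]) h s.
  move=> u0; rewrite /oriented_integral u0 RintegralD//; exact: locally_integrable_itv.
have ae0 : {ae mu, forall t, 0 <= t -> \int[mu]_(s in `[0, t]) h s = 0}.
  case: hsol => _ _ _ + _; apply: ae_imply => u hu u0.
  have [zu0 _] := hu u0; apply/eqP; move: zu0; rewrite zE// ?lexx ?ler01//.
  by rewrite addr0 subr0 prim// => /eqP; rewrite mulf_eq0 gt_eqF.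
rewrite le_eqVlt => /predU1P[<-|t0].
  by rewrite prim// set_itv1 Rintegral_set1.
rewrite prim ?ltW//; apply: contrapT => /eqP nz.
have T0 : 0 <= t + 1 by rewrite addr_ge0// ltW.
have hi := locally_integrable_itv 0 (t + 1) true false lh.
have := parameterized_integral_continuous T0 hi.
rewrite continuous_within_itvP ?ltr_wpDl// ?(ltW t0)//.
move=> [/(_ t) + _ _]; rewrite in_itv/= t0 ltrDl ltr01 => /(_ isT) ct.
have : \forall s \near t, \int[mu]_(x in `[0, s]) h x != 0.
  exact: (@cvgr_neq0 R R^o _ _ _ _ _ ct nz).
move=> /nbhs_ballP[e /= e0 He].
(* A primitive that is nonzero at [t] is nonzero on an interval, which
   contradicts its vanishing almost everywhere. *)
have te : Num.max 0 (t - e) < t + e.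
  by rewrite gt_max; apply/andP; split; lra.
have [s] := ae_itv_witness te ae0.
rewrite gt_max => /andP[/andP[s0 s1] s2] /(_ (ltW s0)) hs0.
have : ball t e s by rewrite /ball/= ltr_norml; apply/andP; split; lra.
by move/He; rewrite hs0 eqxx.
Qed.

(** Differentiate the previous identity. *)
Lemma reflection_at_zero : {ae mu, forall t, 0 < t -> f t = - G t}.
Proof.
pose h s := F s + G s.
have lG := outgoing_locally_integrable.
have lh : locally_integrable [set: R] h by exact: locally_integrableD.
have all0 t : 0 < t -> \int[mu]_(s in `[0, t]) h s = 0.
  move=> t0; have := boundary_primitive (ltW t0).
  rewrite /oriented_integral (ltW t0) -RintegralD//; exact: locally_integrable_itv.
have step n : {ae mu, forall t, 0 < t < n%:R -> h t = 0}.
  by apply: ae_eq0_primitive => // t /andP[t0 _]; exact: all0.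
have := ae_foralln step; apply: ae_imply => t ht t0.
have tn : t < (Num.truncn t).+1%:R by exact: truncnS_gt.
have := ht (Num.truncn t).+1; rewrite t0 tn => /(_ isT).
by rewrite /h FE// => /eqP; rewrite addr_eq0 => /eqP.
Qed.

Let FG : {ae mu, forall s, 0 < s -> F s = - G s}.
Proof. by apply: ae_imply reflection_at_zero => s + s0 => /(_ s0) <-; rewrite FE. Qed.

(** The pair (velocity, minus the slope) at [x = 1] is the inverse rotation of
    [(g (t - 1), - f (t + 1))], and [- f = g] on the positive axis. *)
Lemma outgoing_iterates : {ae mu, forall s, -1 < s -> S (G s) (G (s + 2))}.
Proof.
have sh := @ae_measure_preserving R _ (measure_preserving_shift (1 : R)).
have sh2 := sh _ (sh _ reflection_at_zero).
case: hsol => _ _ _ /sh + _; move: sh2.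
apply: ae_imply2 => s fG ht s1.
have [|_ Sig] := ht; first by lra.
apply/(map_of_rotationP hS); move: Sig.
rewrite /wave_t /wave_x outgoingE//.
rewrite (_ : 1 + s - 1 = s); last by ring.
rewrite (_ : 1 + s + 1 = s + 2); last by ring.
have := fG; rewrite (_ : 1 + (1 + s) = s + 2); last by ring.
move=> ->; last by lra.
rewrite -mulNr opprD !opprK.
by rewrite (addrC (- _)) [in X in _ -> Sigma (_, X)]addrC.
Qed.

(** Reflection at [x = 0] leaves a single integral of the profile over the
    symmetric window [(t - x, t + x)]; centering it at [t] exhibits the
    displacement as a primitive in [x]. *)
Lemma solution_repr t x : 0 <= t -> 0 <= x <= 1 ->
  z t x = \int[mu]_(s in `[0, x]) (- c * (G (t + s) + G (t - s))).
Proof.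
move=> t0 x01; have /andP[x0 x1] := x01.
have lG := outgoing_locally_integrable; have [mG _ _] := lG.
have iG2 : mu.-integrable `[0, x] (EFin \o (fun s => G (t + s) + G (t - s))).
  apply: locally_integrable_itv; apply: locally_integrableD.
    exact: locally_integrable_shift.
  exact: locally_integrable_reflection.
rewrite RintegralZl//.
rewrite -Rintegral_symmetric_window// -oriented_integralB//; last by lra.
have tx0 : 0 <= t + x by rewrite addr_ge0.
have := boundary_primitive tx0 => /eqP; rewrite addr_eq0 => /eqP FG0.
by rewrite zE// FG0; ring.
Qed.

Lemma solution_is_weak_derivative t : 0 <= t ->
  is_weak_derivative (z t) (fun x => - c * (G (t + x) + G (t - x))).
Proof.
move=> t0; apply: weak_derivative_primitive.
  have lG := outgoing_locally_integrable.
  have := locally_integrableD (locally_integrable_shift t lG)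
    (locally_integrable_reflection t lG).
  move=> /(locally_integrable_itv 0 1 false true) iG2.
  by apply: (integrableZl _ (- c)) iG2.
by move=> x /andP[x0 x1]; rewrite solution_repr// !ltW.
Qed.

(** The two combinations in the norm isolate the incoming and the outgoing
    waves, and after reflection both are values of the same profile. *)
Lemma energy_density t : 0 <= t ->
  [/\ measurable_fun (`]0, 1[%classic : set R) (weak_derivative (z t)),
      measurable_fun (`]0, 1[%classic : set R) (wave_t f g t)
    & {ae mu, forall x, 0 < x < 1 ->
        `|weak_derivative (z t) x + wave_t f g t x| = Num.sqrt 2 * `|G (t + x)| /\
        `|weak_derivative (z t) x - wave_t f g t x| = Num.sqrt 2 * `|G (t - x)|}].
Proof.
move=> t0; have [mdu du] := weak_derivativeP (solution_is_weak_derivative t0).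
have [mG _ _] := outgoing_locally_integrable.
have [mF _ _] := lF.
have vE x : 0 < x < 1 -> wave_t f g t x = (F (t + x) + G (t - x)) * c.
  move=> /andP[x0 x1]; rewrite /wave_t outgoingE ?FE ?ltr_wpDl//; lra.
have pS := measure_preserving_shift t.
have pR := measure_preserving_reflection t.
split=> //.
  apply: (@eq_measurable_fun _ _ _ _ _ (fun x => (F (t + x) + G (t - x)) * c)).
    by move=> x /set_mem /=; rewrite in_itv/= => /vE ->.
  apply: measurable_funTS; apply: measurable_funM; last exact: measurable_cst.
  by apply: measurable_funD; [exact: (measurableT_comp mF pS.1)|exact: (measurableT_comp mG pR.1)].
have FGt := ae_measure_preserving pS FG.
apply: ae_imply2 FGt du => x Fx dux x01.
have /andP[x0 x1] := x01.
rewrite vE// dux// Fx ?ltr_wpDl//.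
have s2 : 2 * c = Num.sqrt 2.
  by rewrite -[X in X * c](@sqr_sqrtr _ (2 : R))// expr2 mulfK// sqrtr_eq0 -ltNge.
split.
  rewrite (_ : _ + _ = - (2 * c) * G (t + x)); last by ring.
  by rewrite s2 mulNr normrN normrM ger0_norm ?sqrtr_ge0.
rewrite (_ : _ - _ = - (2 * c) * G (t - x)); last by ring.
by rewrite s2 mulNr normrN normrM ger0_norm ?sqrtr_ge0.
Qed.

Lemma Loo_norm_leP (h : R -> R) (M : R) : 0 <= M ->
  (Loo_norm h <= M%:E)%E <-> {ae mu, forall x, 0 < x < 1 -> `|h x| <= M}.
Proof.
move=> M0; rewrite /Loo_norm unlock /= lebesgue_measure_setT_gt0; split.
  move=> /ess_supP; apply: ae_imply => x /= + x01.
  by rewrite lee_fin patchE mem_set//= in_itv/=.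
move=> hM; apply/ess_supP; apply: ae_imply hM => x hx /=.
rewrite lee_fin patchE; case: ifPn => [/set_mem/=|_]; last by rewrite normr0.
by rewrite in_itv/= => /hx.
Qed.

(** The window [(t - 1, t + 1)] is, up to its center, the union of a translate
    and of a reflection of [(0, 1)]. *)
Lemma ae_window (P : R -> Prop) (t : R) :
  {ae mu, forall s, t - 1 < s < t + 1 -> P s} <->
  {ae mu, forall x, 0 < x < 1 -> P (t + x)} /\
  {ae mu, forall x, 0 < x < 1 -> P (t - x)}.
Proof.
split=> [H|[H1 H2]].
  split.
    have := ae_measure_preserving (measure_preserving_shift t) H.
    by apply: ae_imply => x Hx x01; apply: Hx; lra.
  have := ae_measure_preserving (measure_preserving_reflection t) H.
  by apply: ae_imply => x Hx x01; apply: Hx; lra.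
have H1' := ae_measure_preserving (measure_preserving_shift (- t)) H1.
have H2' := ae_measure_preserving (measure_preserving_reflection t) H2.
have Ht : {ae mu, forall s, s != t}.
  exists [set t]; split; [exact: measurable_set1|exact: lebesgue_measure_set1|].
  by move=> s /= /negP; rewrite negbK => /eqP.
have H12 : {ae mu, forall s, (0 < - t + s < 1 -> P s) /\ (0 < t - s < 1 -> P s)}.
  apply: ae_imply2 H1' H2' => s.
  rewrite (_ : t + (- t + s) = s); last by ring.
  by rewrite (_ : t - (t - s) = s); last by ring.
apply: ae_imply2 H12 Ht => s [P1 P2] st s1.
have [ts|ts|ts] := ltgtP s t; [apply: P2|apply: P1|by move: st; rewrite ts eqxx]; lra.
Qed.

Lemma energy_Loo_leP t r : 0 <= t -> 0 <= r ->
  (energy +oo%E z f g t <= r%:E)%E <->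
  {ae mu, forall s, t - 1 < s < t + 1 -> `|G s| <= r}.
Proof.
move=> t0 r0; have [_ _ H] := energy_density t0.
have s0 : 0 < Num.sqrt 2 :> R by rewrite sqrtr_gt0.
have sr0 : 0 <= Num.sqrt 2 * r by rewrite mulr_ge0// ltW.
rewrite /energy /X_norm /=.
rewrite -lee_pdivlMl ?invr_gt0// invrK -EFinM ge_max; split.
  move=> /andP[/(Loo_norm_leP _ sr0) H1 /(Loo_norm_leP _ sr0) H2].
  apply/ae_window; split.
    apply: ae_imply2 H H1 => x /[swap] + /[swap] x01 => /(_ x01) + /(_ x01)[].
    by move=> le e _; move: le; rewrite e ler_pM2l.
  apply: ae_imply2 H H2 => x /[swap] + /[swap] x01 => /(_ x01) + /(_ x01)[].
  by move=> le _ e; move: le; rewrite e ler_pM2l.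
move=> /ae_window[H1 H2]; apply/andP; split; apply/Loo_norm_leP => //.
  apply: ae_imply2 H H1 => x /[swap] + /[swap] x01 => /(_ x01) + /(_ x01)[].
  by move=> + -> _; rewrite ler_pM2l.
apply: ae_imply2 H H2 => x /[swap] + /[swap] x01 => /(_ x01) + /(_ x01)[].
by move=> + _ ->; rewrite ler_pM2l.
Qed.

Lemma powR_sqrt2 (q : R) : 2 `^ (- (q / 2)) * Num.sqrt 2 `^ q = 1.
Proof.
rewrite -powR12_sqrt// -powRrM -powRD.
  by rewrite (_ : - (q / 2) + 2^-1 * q = 0) ?powRr0//; ring.
by apply/implyP => _; rewrite pnatr_eq0.
Qed.

Lemma energy_Lp q t : 1 <= q -> 0 <= t ->
  energy q%:E z f g t =
  ((\int[mu]_(s in `](t - 1)%R, (t + 1)%R[) (`|G s| `^ q)%:E) `^ q^-1)%E.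
Proof.
move=> q1 t0; have [mdu mv H] := energy_density t0.
rewrite /energy /X_norm /=; congr (_ `^ _)%E.
have [mG _ _] := outgoing_locally_integrable.
pose N s : \bar R := (`|G s| `^ q)%:E.
have mN : measurable_fun [set: R] N.
  apply: measurableT_comp => //; apply: (measurableT_comp (measurable_powR q)).
  exact: measurableT_comp.
have pS := measure_preserving_shift t.
have pR := measure_preserving_reflection t.
have N0 s : (0 <= N s)%E by rewrite lee_fin powR_ge0.
have mNS : measurable_fun [set: R] (fun x => N (t + x)) by exact: measurableT_comp mN pS.1.
have mNR : measurable_fun [set: R] (fun x => N (t - x)) by exact: measurableT_comp mN pR.1.
have -> : (\int[mu]_(x in `]0%R, 1%R[)
      (`|weak_derivative (z t) x + wave_t f g t x| `^ q +
       `|weak_derivative (z t) x - wave_t f g t x| `^ q)%R%:E =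
   \int[mu]_(x in `]0%R, 1%R[) ((Num.sqrt 2 `^ q)%R%:E * (N (t + x)%R + N (t - x)%R)))%E.
  apply: ae_eq_integral.
  - exact: measurable_itv.
  - apply: measurableT_comp => //; apply: measurable_funD.
      apply: (measurableT_comp (measurable_powR q)); apply: measurableT_comp => //.
      exact: measurable_funD.
    apply: (measurableT_comp (measurable_powR q)); apply: measurableT_comp => //.
    exact: measurable_funB.
  - apply: measurable_funTS; apply: measurable_funeM; exact: emeasurable_funD.
  - apply: ae_imply H => x Hx; rewrite /= in_itv/= => /Hx[-> ->].
    by rewrite !powRM ?sqrtr_ge0// -EFinD -EFinM mulrDr.
rewrite ge0_integralZl//; first last.
- by move=> x _; exact: adde_ge0.
- by apply: measurable_funTS; exact: emeasurable_funD.
rewrite muleA -EFinM powR_sqrt2 mul1e ge0_integralD//; first last.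
- exact: measurable_funTS.
- exact: measurable_funTS.
have ES : (fun s => t + s) @^-1` `]t, t + 1[ = `]0, 1[%classic.
  by apply/seteqP; split=> s /=; rewrite !in_itv/=; lra.
have ER : (fun s => t - s) @^-1` `]t - 1, t[ = `]0, 1[%classic.
  by apply/seteqP; split=> s /=; rewrite !in_itv/=; lra.
rewrite -{1}ES -(ge0_integral_measure_preserving pS (f := N))//; last exact: measurable_funTS.
rewrite -ER -(ge0_integral_measure_preserving pR (f := N))//; last exact: measurable_funTS.
rewrite addeC integral_itv_bndo_bndc; last exact: measurable_funTS.
rewrite -ge0_integral_setU//.
- by congr (integral _ _ _); rewrite -itv_bndbnd_setU// bnd_simp; lra.
- exact: measurable_funTS.
- apply/disj_setPS => y [/=]; rewrite 2!in_itv/= => /andP[_ yt] /andP[].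
  by rewrite ltNge yt.
Qed.

End SolutionStructure.

(** * Iterated sequences along the profile of a solution *)

Section EnergyLimit.
Context {R : realType}.

Lemma cvge0_pinftyP (u : R -> \bar R) : (forall t, 0 <= t -> (0 <= u t)%E) ->
  (u t @[t --> +oo%R] --> 0%E <->
   forall eps : R, 0 < eps -> exists T, forall t, T <= t -> (u t <= eps%:E)%E).
Proof.
move=> u0; split=> [/fine_cvgP[ufin ucvg] eps eps0|H].
  have ule : \forall t \near +oo, (u t <= eps%:E)%E.
    have uf : \forall t \near +oo, fine (u t) < eps.
      by apply: (cvgr_lt (0 : R)).
    near=> t; rewrite -[u t]fineK; last by near: t.
    by rewrite lee_fin ltW//; near: t.
  have [T [_ HT]] := ule; exists (T + 1) => t Tt; apply: HT.
  by rewrite (lt_le_trans _ Tt)// ltrDl.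
have bnd eps : 0 < eps -> \forall t \near +oo, (0 <= u t <= eps%:E)%E.
  move=> eps0; have [T HT] := H eps eps0.
  near=> t; rewrite u0 ?HT//; near: t; exact: nbhs_pinfty_ge.
apply/fine_cvgP; split.
  near=> t; have : (0 <= u t <= 1%:E)%E by near: t; exact: bnd.
  by move=> /andP[ut0 ut1]; rewrite ge0_fin_numE// (le_lt_trans ut1)// ltry.
apply/cvgrPdist_le => eps eps0; near=> t.
have : (0 <= u t <= eps%:E)%E by near: t; exact: bnd.
move=> /andP[ut0 ut1].
have utf : u t \is a fin_num by rewrite ge0_fin_numE// (le_lt_trans ut1)// ltry.
rewrite sub0r normrN ger0_norm ?fine_ge0// -lee_fin fineK//.
Unshelve. all: by end_near. Qed.

End EnergyLimit.

Section Iterates.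
Context {R : realType}.
Local Notation mu := (@lebesgue_measure R).
Variables (S : R -> set R) (G : R -> R).
Hypothesis Sle : forall x y, S x y -> `|y| <= `|x|.
Hypothesis lG : locally_integrable [set: R] G.
Hypothesis GS : {ae mu, forall s, -1 < s -> S (G s) (G (s + 2))}.

Lemma iterated_sequence_le x m n : iterated_sequence S x -> (m <= n)%N ->
  `|x n| <= `|x m|.
Proof.
move=> xS /subnK <-; elim: (n - m)%N => [|k IH]; first by rewrite add0n.
by rewrite addSn (le_trans _ IH)//; apply: Sle; exact: xS.
Qed.

(** A countable intersection of sets of full measure, each the translate of the
    set where the inclusion holds. *)
Lemma ae_iterated_sequence : {ae mu, forall s, -1 < s ->
  iterated_sequence S (fun n => G (2 * n%:R + s))}.
Proof.
have step n : {ae mu, forall s, -1 < s -> S (G (2 * n%:R + s)) (G (2 * n.+1%:R + s))}.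
  have := ae_measure_preserving (measure_preserving_shift (2 * n%:R)) GS.
  apply: ae_imply => s Hs s1.
  rewrite (_ : 2 * n.+1%:R + s = 2 * n%:R + s + 2).
    by apply: Hs; rewrite ltr_wpDl// mulr_ge0.
  by rewrite -natr1; ring.
by have := ae_foralln step; apply: ae_imply => s Hs s1 n; exact: Hs.
Qed.

(** Every point of the window lies, up to countably many exceptions, in exactly
    one period [(2 n - 1, 2 n + 1)], and [t <= 2 n + 2] for such an [n]; so
    there the profile is the [n]-th term of an iterated sequence. *)
Lemma ae_iterated_window (r b t : R) : 0 <= t ->
  {ae mu, forall s, -1 < s < 1 -> `|G s| <= r} ->
  (forall x, iterated_sequence S x -> `|x 0%N| <= r ->
    forall n, t <= 2 * n%:R + 2 -> `|x n| <= b) ->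
  {ae mu, forall s, t - 1 < s < t + 1 -> `|G s| <= b}.
Proof.
move=> t0 Gr Hb.
have H : {ae mu, forall s, -1 < s < 1 ->
    forall n, t <= 2 * n%:R + 2 -> `|G (2 * n%:R + s)| <= b}.
  apply: ae_imply2 ae_iterated_sequence Gr => s s1 sr s11 n tn.
  have /andP[s1' _] := s11.
  apply: (Hb (fun n => G (2 * n%:R + s))) => //; first exact: s1.
  by rewrite mulr0 add0r; exact: sr.
have Hn n : {ae mu, forall s, (- 1 < s - 2 * n%:R < 1 -> t <= 2 * n%:R + 2 ->
    `|G s| <= b) /\ s != 2 * n%:R - 1}.
  have Hs := ae_measure_preserving (measure_preserving_shift (- (2 * n%:R))) H.
  (* The boundaries between periods are negligible. *)
  have Ht : {ae mu, forall s, s != 2 * n%:R - 1}.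
    exists [set 2 * n%:R - 1]; split;
      [exact: measurable_set1|exact: lebesgue_measure_set1|].
    by move=> s /= /negP; rewrite negbK => /eqP.
  apply: ae_imply2 Hs Ht => s Hs Ht; split=> // s1 tn.
  have := Hs _ n tn; rewrite (_ : 2 * n%:R + _ = s); last by ring.
  by apply; rewrite addrC.
have := ae_foralln Hn; apply: ae_imply => s Hs /andP[ts st].
have s0 : 0 <= (s + 1) / 2 by rewrite divr_ge0//; lra.
have /andP[n1 n2] := truncn_itv s0.
set n := Num.truncn _ in n1 n2.
have n1' : 2 * n%:R - 1 <= s.
  by move: n1; rewrite ler_pdivlMr//; lra.
have n2' : s < 2 * n%:R + 1.
  by move: n2; rewrite ltr_pdivrMr// -natr1; lra.
have [Hn1 Hn2] := Hs n; apply: Hn1; last by lra.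
have : 2 * n%:R - 1 < s by rewrite lt_neqAle eq_sym Hn2.
by move=> ?; apply/andP; split; lra.
Qed.

(** Dominated convergence on the periods centered at [2 n]; an arbitrary window
    is covered by two consecutive periods. *)
Lemma Lp_window_cvg0 (q : R) : 1 <= q ->
  mu.-integrable `](-1)%R, 1%R[ (fun s => (`|G s| `^ q)%:E) ->
  converge_simply_to_zero S ->
  forall eps : R, 0 < eps -> exists T, forall t, T <= t ->
    (\int[mu]_(s in `](t - 1)%R, (t + 1)%R[) (`|G s| `^ q)%:E <= eps%:E)%E.
Proof.
move=> q1 iq S0.
have [mG _ _] := lG.
have q0 : 0 < q by exact: lt_le_trans q1.
pose N s : \bar R := (`|G s| `^ q)%:E.
have mN : measurable_fun [set: R] N.
  apply: measurableT_comp => //; apply: (measurableT_comp (measurable_powR q)).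
  exact: measurableT_comp.
have N0 s : (0 <= N s)%E by rewrite lee_fin powR_ge0.
pose a n := (\int[mu]_(s in `](2 * n%:R - 1)%R, (2 * n%:R + 1)%R[) N s)%E.
have aE n : a n = (\int[mu]_(s in `](-1)%R, 1%R[) N (2 * n%:R + s)%R)%E.
  rewrite /a (ge0_integral_measure_preserving (measure_preserving_shift (2 * n%:R)) (f := N))//.
    congr (integral _ _ _).
    by apply/seteqP; split=> s /=; rewrite !in_itv/=; lra.
  exact: measurable_funTS.
have a_cvg : a n @[n --> \oo] --> 0%E.
  have [||||||_ _] := @dominated_convergence _ _ _ mu (`](-1)%R, 1%R[%classic : set R) _
    (fun n s => N (2 * n%:R + s)) (cst 0%E) N.
  - exact: measurable_itv.
  - move=> n; apply: measurable_funTS.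
    exact: measurableT_comp mN (measure_preserving_shift _).1.
  - exact: measurable_cst.
  - apply: ae_imply ae_iterated_sequence => s Hs; rewrite /= in_itv/= => /andP[s1 _].
    have xc := S0 _ (Hs s1).
    apply/fine_cvgP; split; first by apply: nearW.
    apply/cvgrPdist_le => e e0; near=> n.
    rewrite sub0r normrN /= ger0_norm ?powR_ge0//.
    have -> : e = (e `^ q^-1) `^ q.
      by rewrite -powRrM mulVf ?powRr1 ?gt_eqF// ltW.
    rewrite ge0_ler_powR ?nnegrE ?powR_ge0//; first exact: ltW.
    near: n; move/cvgr0Pnorm_le : xc; apply.
    exact: powR_gt0.
  - exact: iq.
  - apply: ae_imply ae_iterated_sequence => s Hs n; rewrite /= in_itv/= => /andP[s1 _].
    rewrite lee_fin ger0_norm ?powR_ge0// ge0_ler_powR ?nnegrE//; first exact: ltW.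
    have := iterated_sequence_le (Hs s1) (leq0n n).
    by rewrite mulr0 add0r.
  by rewrite integral0 => H; apply: cvg_trans H; apply: near_eq_cvg; apply: nearW => n /=; rewrite aE.
move=> eps eps0.
have e2 : 0 < eps / 2 by rewrite divr_gt0.
(* Each of the two periods that meet the window gets half of [eps]. *)
have [n0 _ Hn0] : \forall n \near \oo, (a n <= (eps / 2)%:E)%E.
  move/fine_cvgP : a_cvg => [afin acvg].
  have uf : \forall n \near \oo, fine (a n) < eps / 2.
    by apply: (cvgr_lt (0 : R)).
  near=> n; rewrite -[a n]fineK; last by near: n.
  by rewrite lee_fin ltW//; near: n.
exists (2 * n0%:R) => t tn0.
have t0 : 0 <= t / 2 by rewrite divr_ge0// (le_trans _ tn0)// mulr_ge0.
have /andP[n1 n2] := truncn_itv t0.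
set n := Num.truncn _ in n1 n2.
have n1' : 2 * n%:R <= t by move: n1; rewrite ler_pdivlMr// mulrC.
have n2' : t < 2 * n%:R + 2 by move: n2; rewrite ltr_pdivrMr// -natr1; lra.
have n0n : (n0 <= n)%N.
  by rewrite -ltnS -(ltr_nat R) (le_lt_trans _ n2)// ler_pdivlMr// mulrC.
have -> : eps%:E = ((eps / 2)%:E + (eps / 2)%:E)%E.
  by rewrite -EFinD; congr EFin; lra.
apply: le_trans (leeD (Hn0 n n0n) (Hn0 n.+1 (leqW n0n))).
rewrite /a [X in (X + _)%E]integral_itv_bndo_bndc; last exact: measurable_funTS.
rewrite [X in (X + _)%E](_ : _ = \int[mu]_(s in `](2 * n%:R - 1)%R, (2 * n.+1%:R - 1)%R]) N s)%E; last first.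
  by rewrite (_ : 2 * n.+1%:R - 1 = 2 * n%:R + 1 :> R)// -natr1; ring.
rewrite -ge0_integral_setU//.
- apply: ge0_subset_integral => //.
  + by apply: measurableU; exact: measurable_itv.
  + exact: measurable_funTS.
  + move=> s /=; rewrite !in_itv/= -natr1 => /andP[ts st].
    have [sn|sn] := leP s (2 * (n%:R + 1) - 1); [left|right]; apply/andP; split=> //; lra.
- exact: measurable_funTS.
- apply/disj_setPS => y [/=]; rewrite 2!in_itv/= => /andP[_ yt] /andP[].
  by rewrite ltNge yt.
Unshelve. all: by end_near. Qed.

End Iterates.

(** * A KL bound from uniform convergence *)

Section KLBound.
Context {R : realType}.
Variable S : R -> set R.
Hypothesis S00 : S 0 0.
Hypothesis Sle : forall x y, S x y -> `|y| <= `|x|.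

(** The two penalties make the supremum below Lipschitz continuous in the radius
    [r] and in the time [t].  They vanish when [|x 0| <= r] and
    [t <= 2 n + 2], so that the supremum still bounds [|x n|] in that case.
    The factor 2 lets sequences that start outside the ball of radius [2 r]
    contribute nothing positive. *)
Definition decay_value (r t : R) (x : nat -> R) (n : nat) : R :=
  `|x n| - 2 * Num.max 0 (`|x 0%N| - r) - Num.max 0 (t - (2 * n%:R + 2)).

Definition decay_values (r t : R) : set R :=
  [set v | exists x n, iterated_sequence S x /\ v = decay_value r t x n].

Definition decay (r t : R) : R := sup (decay_values r t).

Lemma decay_value_le_start r t x n : iterated_sequence S x ->
  decay_value r t x n <= `|x 0%N| - 2 * Num.max 0 (`|x 0%N| - r).
Proof.
move=> xS; rewrite /decay_value.
have := iterated_sequence_le Sle xS (leq0n n).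
have : 0 <= Num.max 0 (t - (2 * n%:R + 2)) by rewrite le_max lexx.
lra.
Qed.

Lemma decay_value_le r t x n : iterated_sequence S x -> decay_value r t x n <= r.
Proof.
move=> xS; apply: (le_trans (decay_value_le_start r t n xS)).
have [h|h] := leP (`|x 0%N| - r) 0; lra.
Qed.

Lemma decay_values_bounded r t : has_ubound (decay_values r t).
Proof. by exists r => _ [x [n [xS ->]]]; exact: decay_value_le. Qed.

Lemma zero_iterated : iterated_sequence S (fun=> 0).
Proof. by move=> n. Qed.

Lemma decay_values_nonempty r t : decay_values r t !=set0.
Proof.
by exists (decay_value r t (fun=> 0) 0), (fun=> 0), 0%N; split=> //; exact: zero_iterated.
Qed.

Lemma decay_value_le_decay r t x n : iterated_sequence S x ->
  decay_value r t x n <= decay r t.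
Proof.
by move=> xS; apply: (ub_le_sup (decay_values_bounded r t)); exists x, n.
Qed.

Lemma decay_le r t b :
  (forall x n, iterated_sequence S x -> decay_value r t x n <= b) ->
  decay r t <= b.
Proof.
move=> H; apply: ge_sup; first exact: decay_values_nonempty.
by move=> _ [x [n [xS ->]]]; exact: H.
Qed.

Lemma le_decay r t x n : iterated_sequence S x -> `|x 0%N| <= r ->
  t <= 2 * n%:R + 2 -> `|x n| <= decay r t.
Proof.
move=> xS xr tn; have := decay_value_le_decay r t n xS.
rewrite /decay_value max_l; last by rewrite subr_le0.
by rewrite max_l ?subr_le0// mulr0 !subr0.
Qed.

(** The zero sequence, taken at an index that is large with respect to [t]. *)
Lemma decay_ge0 r t : 0 <= r -> 0 <= decay r t.
Proof.
move=> r0; pose n := (Num.truncn t).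
have tn : t <= 2 * n%:R + 2.
  have := truncnS_gt t; rewrite -/n -natr1 => tn.
  have : 0 <= n%:R :> R by []. lra.
by have := le_decay zero_iterated (n := n) (r := r) (t := t); rewrite normr0; apply.
Qed.

Lemma decay_le_radius r t : decay r t <= r.
Proof. by apply: decay_le => x n; exact: decay_value_le. Qed.

Lemma decay_homo r1 r2 t1 t2 : r1 <= r2 -> t2 <= t1 -> decay r1 t1 <= decay r2 t2.
Proof.
move=> r12 t12; apply: decay_le => x n xS.
apply: le_trans (decay_value_le_decay r2 t2 n xS); rewrite /decay_value.
have h1 : Num.max 0 (`|x 0%N| - r2) <= Num.max 0 (`|x 0%N| - r1).
  by rewrite ge_max !le_max lexx/= lerD2l lerN2 r12 orbT.
have h2 : Num.max 0 (t2 - (2 * n%:R + 2)) <= Num.max 0 (t1 - (2 * n%:R + 2)).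
  by rewrite ge_max !le_max lexx/= lerD2r t12 orbT.
lra.
Qed.

Lemma max0_lipschitz (a b : R) : Num.max 0 a <= Num.max 0 b + `|a - b|.
Proof.
have := ler_norm (a - b); have := normr_ge0 (a - b).
have [?|?] := leP a 0; have [?|?] := leP b 0; lra.
Qed.

Lemma decay_lipschitz r1 r2 t1 t2 :
  decay r1 t1 <= decay r2 t2 + (2 * `|r1 - r2| + `|t1 - t2|).
Proof.
apply: decay_le => x n xS.
have := decay_value_le_decay r2 t2 n xS; rewrite /decay_value.
have h1 := max0_lipschitz (`|x 0%N| - r2) (`|x 0%N| - r1).
have h2 := max0_lipschitz (t2 - (2 * n%:R + 2)) (t1 - (2 * n%:R + 2)).
rewrite (_ : `|x 0%N| - r2 - (`|x 0%N| - r1) = r1 - r2) in h1; last by ring.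
rewrite (_ : _ - _ - (t1 - _) = - (t1 - t2)) ?normrN in h2; last by ring.
lra.
Qed.

Lemma continuous_decay : continuous (fun q : R * R => decay q.1 q.2).
Proof.
move=> q; apply/cvgrPdist_le => e e0.
have e4 : 0 < e / 4 by rewrite divr_gt0.
near=> s.
have s1 : `|q.1 - s.1| <= e / 4.
  by near: s; move: (e / 4) e4; apply/(@cvgrPdist_le _ R^o); exact: cvg_fst.
have s2 : `|q.2 - s.2| <= e / 4.
  by near: s; move: (e / 4) e4; apply/(@cvgrPdist_le _ R^o); exact: cvg_snd.
have := decay_lipschitz q.1 s.1 q.2 s.2.
have := decay_lipschitz s.1 q.1 s.2 q.2.
rewrite (distrC s.1) (distrC s.2) => h1 h2.
by rewrite ler_norml; apply/andP; split; lra.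
Unshelve. all: by end_near. Qed.

Hypothesis Sunif : converge_uniformly_to_zero S.

(** Sequences that start outside the ball of radius [2 r] contribute
    nonpositive values; for the others uniform convergence handles the large
    indices, and the penalty in time handles the finitely many remaining ones. *)
Lemma decay_cvg0 r : 0 <= r -> decay r t @[t --> +oo%R] --> (0 : R).
Proof.
move=> r0; apply/cvgrPdist_le => e e0.
have r20 : 0 <= 2 * r by rewrite mulr_ge0.
have [N HN] := Sunif r20 e0.
near=> t.
rewrite sub0r normrN ger0_norm ?decay_ge0//.
have tN : 2 * N%:R + 2 + 2 * r <= t.
  by near: t; apply: nbhs_pinfty_ge; rewrite num_real.
apply: decay_le => x n xS.
have [xr|xr] := leP `|x 0%N| (2 * r); last first.
  apply: (le_trans (decay_value_le_start r t n xS)).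
  rewrite max_r; lra.
have p1 : 0 <= Num.max 0 (`|x 0%N| - r) by rewrite le_max lexx.
have p2 : 0 <= Num.max 0 (t - (2 * n%:R + 2)) by rewrite le_max lexx.
have [Nn|nN] := leqP N n.
  have := HN (x 0%N) xr x xS erefl n Nn; rewrite /decay_value; lra.
have := iterated_sequence_le Sle xS (leq0n n).
have nNr : n%:R <= N%:R :> R by rewrite ler_nat ltnW.
rewrite /decay_value [X in _ - X <= _]max_r; lra.
Unshelve. all: by end_near. Qed.

(** The second term makes the monotonicity strict in both variables. *)
Definition KL_bound (r t : R) : R := decay r t + r * expR (- t).

Lemma KL_KL_bound : KL KL_bound.
Proof.
split.
- apply: continuous_subspaceT => q; apply: cvgD; first exact: continuous_decay.
  apply: cvgM; first exact: cvg_fst.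
  apply: continuous_cvg; first exact: continuous_expR.
  by apply: cvgN; exact: cvg_snd.
- move=> r t r0 _; rewrite addr_ge0 ?decay_ge0// mulr_ge0// expR_ge0.
- move=> t t0; split.
    rewrite /KL_bound mul0r addr0; apply/eqP; rewrite eq_le decay_ge0// andbT.
    exact: decay_le_radius.
  move=> x y x0 xy; apply: ler_ltD; first by apply: decay_homo => //; exact: ltW.
  by rewrite ltr_pM2r// expR_gt0.
- move=> x x0 s t s0 st; apply: ler_ltD; first by apply: decay_homo => //; exact: ltW.
  by rewrite ltr_pM2l// ltr_expR ltrN2.
- move=> x x0; rewrite -[X in _ --> X](addr0 (0:R)); apply: cvgD.
    exact: decay_cvg0.
  rewrite -[X in _ --> X](mulr0 x); apply: cvgMr; exact: cvgr_expR.
Qed.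

Lemma le_KL_bound r t x n : 0 <= r -> iterated_sequence S x -> `|x 0%N| <= r ->
  t <= 2 * n%:R + 2 -> `|x n| <= KL_bound r t.
Proof.
move=> r0 xS xr tn; apply: (le_trans (le_decay xS xr tn)).
by rewrite lerDl mulr_ge0// expR_ge0.
Qed.

End KLBound.

(** * Step profiles *)

Section StepProfile.
Context {R : realType}.
Local Notation mu := (@lebesgue_measure R).

Lemma measurable_truncn_level (h : R -> R) (n : nat) :
  measurable_fun [set: R] h ->
  measurable ([set s | Num.truncn (h s) = n] : set R).
Proof.
move=> mh.
have mle m : measurable ([set s | (Num.truncn (h s) <= m)%N] : set R).
  rewrite (_ : [set s | _] = h @^-1` `]-oo, m.+1%:R[%classic).
    by rewrite -[X in measurable X]setTI; apply: mh => //; exact: measurable_itv.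
  by apply/seteqP; split=> s /=; rewrite in_itv/= truncn_le_nat.
case: n => [|n].
  rewrite (_ : [set s | _] = [set s | (Num.truncn (h s) <= 0)%N])//.
  by apply/seteqP; split=> s /=; rewrite leqn0 => /eqP.
rewrite (_ : [set s | _] = [set s | (Num.truncn (h s) <= n.+1)%N] `\`
    [set s | (Num.truncn (h s) <= n)%N]); first exact: measurableD.
apply/seteqP; split=> s /=.
  by move=> ->; rewrite leqnn ltnn.
by move=> [h1 /negP]; rewrite -ltnNge => h2; apply/eqP; rewrite eqn_leq h1.
Qed.

Lemma measurable_discrete2 (X : nat -> nat -> R) (h1 h2 : R -> R) :
  measurable_fun [set: R] h1 -> measurable_fun [set: R] h2 ->
  measurable_fun [set: R] (fun s => X (Num.truncn (h1 s)) (Num.truncn (h2 s))).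
Proof.
move=> m1 m2 _ B mB; rewrite setTI.
rewrite (_ : _ @^-1` B = \bigcup_k \bigcup_(n in [set n | B (X k n)])
    ([set s | Num.truncn (h1 s) = k] `&` [set s | Num.truncn (h2 s) = n])).
  apply: bigcup_measurable => k _; apply: bigcup_measurable => n _.
  by apply: measurableI; exact: measurable_truncn_level.
apply/seteqP; split=> [s /= Bs|s [k _ [n /= Bn [e1 e2]]]]; last first.
  by rewrite /= e1 e2.
by exists (Num.truncn (h1 s)) => //; exists (Num.truncn (h2 s)).
Qed.

Definition period_index (s : R) : nat := Num.truncn ((s + 1) / 2).

Definition period_phase (s : R) : R := (s + 1) / 2 - (period_index s)%:R.

(** The logarithm cuts the phases in (0, 1) into countably many intervals, one
    for each member of the family. *)
Definition step_profile (X : nat -> nat -> R) (s : R) : R :=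
  X (Num.truncn (- ln (period_phase s))) (period_index s).

Lemma period_index_shift s : -1 <= s -> period_index (s + 2) = (period_index s).+1.
Proof.
move=> s1; have s0 : 0 <= (s + 1) / 2 by rewrite divr_ge0//; lra.
apply: truncn_def; have := truncn_itv s0; rewrite -/(period_index s).
set n := period_index s; rewrite -(natr1 n.+1) -(natr1 n).
by move=> /andP[? ?]; apply/andP; split; lra.
Qed.

Lemma period_phase_shift s : -1 <= s -> period_phase (s + 2) = period_phase s.
Proof.
move=> s1; rewrite /period_phase period_index_shift//.
by rewrite -(natr1 (period_index s)); lra.
Qed.

Lemma period_indexE n s : 2 * n%:R - 1 <= s < 2 * n%:R + 1 -> period_index s = n.
Proof.
by move=> /andP[? ?]; apply: truncn_def; rewrite -(natr1 n); apply/andP; split; lra.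
Qed.

Lemma measurable_step_profile X : measurable_fun [set: R] (step_profile X).
Proof.
have mh : measurable_fun [set: R] (fun s : R => (s + 1) / 2).
  by apply: measurable_funM => //; apply: measurable_funD.
have mph : measurable_fun [set: R] period_phase.
  apply: measurable_funB => //.
  exact: (@measurable_discrete2 (fun _ n => n%:R) (fun s => (s + 1) / 2)).
apply: (@measurable_discrete2 X (fun s => - ln (period_phase s))) => //.
apply: measurableT_comp => //; apply: measurableT_comp mph; exact: measurable_ln.
Qed.

Lemma step_profile_iterates S X s : (forall k, iterated_sequence S (X k)) ->
  -1 <= s -> S (step_profile X s) (step_profile X (s + 2)).
Proof.
move=> XS s1; rewrite /step_profile period_phase_shift// period_index_shift//.
exact: XS.
Qed.

Lemma step_profile_constant_family (x : nat -> R) n s :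
  2 * n%:R - 1 <= s < 2 * n%:R + 1 -> step_profile (fun=> x) s = x n.
Proof. by move=> sn; rewrite /step_profile (period_indexE sn). Qed.

Lemma step_profile_piece X k n s :
  2 * n%:R - 1 + 2 * expR (- k.+1%:R) < s < 2 * n%:R - 1 + 2 * expR (- k%:R) ->
  step_profile X s = X k n.
Proof.
move=> /andP[s1 s2].
have e1 : 0 < expR (- k.+1%:R) :> R by exact: expR_gt0.
have e2 : expR (- k%:R) <= 1 :> R by rewrite expR_le1 oppr_le0.
have sn : period_index s = n by apply: period_indexE; apply/andP; split; lra.
rewrite /step_profile sn; congr (X _ n).
have ph1 : expR (- k.+1%:R) < period_phase s by rewrite /period_phase sn; lra.
have ph2 : period_phase s < expR (- k%:R) by rewrite /period_phase sn; lra.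
have ph0 : 0 < period_phase s by exact: lt_trans ph1.
apply: truncn_def; apply/andP; split.
  by rewrite lerNr -[leRHS]expRK ler_ln ?posrE ?expR_gt0// ltW.
by rewrite ltrNl -[ltLHS]expRK ltr_ln ?posrE ?expR_gt0.
Qed.

End StepProfile.

Section ProfileSolution.
Context {R : realType}.
Local Notation mu := (@lebesgue_measure R).
Variables (Sigma : set (R * R)) (S : R -> set R) (p : \bar R).
Hypothesis hS : graph_of S = rotation @` Sigma.
Hypothesis hp : (1 <= p)%E.
Variables (g : R -> R) (M : R).
Hypothesis mg : measurable_fun [set: R] g.
Hypothesis gM : forall s, `|g s| <= M.
Hypothesis gS : forall s, -1 <= s -> S (g s) (g (s + 2)).

Definition profile_wave (t x : R) : R :=
  (Num.sqrt 2)^-1 * oriented_integral 0 (t + x) (fun s => - g s) +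
  (Num.sqrt 2)^-1 * oriented_integral 0 (t - x) g.

Let mNg : measurable_fun [set: R] (fun s => - g s).
Proof. exact: measurableT_comp. Qed.

Lemma profile_locally_integrable : locally_integrable [set: R] g.
Proof.
apply: locally_integrable_of_itv => // a b.
have : mu.-integrable `]a - 1, b + 1[ (EFin \o g).
  apply: (in_Lp_integrable (lexx 1%E)); apply: (in_Lp_of_bounded (M := M)) => //.
  exact: measurable_funTS.
apply: integrableS => //; apply: subset_itv; rewrite bnd_simp; lra.
Qed.

Lemma profile_wave_solution :
  solution Sigma p (profile_wave 0) (wave_t (fun s => - g s) g 0)
    profile_wave (fun s => - g s) g.
Proof.
split.
- move=> T T0; apply: (in_Lp_of_bounded (M := M)) => //; first exact: measurable_funTS.
  by move=> x _; rewrite normrN.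
- by move=> T T0; apply: (in_Lp_of_bounded (M := M)) => //; exact: measurable_funTS.
- by [].
- apply: aeW => t t0; split.
    rewrite /profile_wave addr0 subr0 -mulrDr /oriented_integral t0.
    rewrite (@eq_Rintegral _ _ _ mu `[0, t]%classic (fun s => -1 * g s)).
      rewrite RintegralZl//; first by rewrite mulN1r addNr mulr0.
      exact: locally_integrable_itv profile_locally_integrable.
    by move=> s _; rewrite mulN1r.
  have : S (g (t - 1)) (g (t + 1)).
    rewrite (_ : t + 1 = t - 1 + 2); last by ring.
    by apply: gS; lra.
  move=> /(map_of_rotationP hS).
  congr (Sigma (_, _)); rewrite /wave_t /wave_x; ring.
- by apply: aeW.
Qed.

(** The initial position is a primitive of a bounded function, hence continuous
    on [[0, 1]] with a bounded weak derivative. *)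
Lemma profile_wave_in_X :
  in_X p (profile_wave 0, wave_t (fun s => - g s) g 0).
Proof.
have sol := profile_wave_solution.
pose G := outgoing g; pose c : R := (Num.sqrt 2)^-1.
have lG := outgoing_locally_integrable hp sol.
have [mG _ _] := lG.
have GM s : `|G s| <= M.
  rewrite /G /outgoing patchE; case: ifP => // _.
  by rewrite normr0; exact: le_trans (gM 0).
pose w x := - c * (G (0 + x) + G (0 - x)).
have dw : is_weak_derivative (profile_wave 0) w.
  exact: (solution_is_weak_derivative hp sol (lexx 0)).
have c0 : 0 < c by rewrite invr_gt0 sqrtr_gt0.
have mw : measurable_fun [set: R] w.
  apply: measurable_funM; first exact: measurable_cst.
  apply: measurable_funD.
    exact: (measurableT_comp mG (measure_preserving_shift 0).1).
  exact: (measurableT_comp mG (measure_preserving_reflection 0).1).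
have wM x : `|w x| <= c * (M + M).
  rewrite /w normrM normrN (gtr0_norm c0) ler_pM2l//.
  by rewrite (le_trans (ler_normD _ _))// lerD.
have repr x : 0 <= x <= 1 -> profile_wave 0 x = \int[mu]_(s in `[0, x]) w s.
  move=> x01; exact: (solution_repr hp sol (lexx 0) x01).
have wLp : in_Lp p 0 1 w.
  by apply: (in_Lp_of_bounded (M := c * (M + M))) => //; exact: measurable_funTS.
have cont : {within `[0, 1], continuous (profile_wave 0)}.
  apply: (@subspace_eq_continuous _ _ _ (fun x => parameterized_integral mu 0 x w)).
    move=> x /set_mem /=; rewrite in_itv/= => x01.
    by rewrite -[RHS]/(profile_wave 0 x) repr.
  apply: parameterized_integral_continuous => //.
  apply: integrableS (_ : mu.-integrable `]-1, 2[ (EFin \o w)) => //.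
    by apply: subset_itv; rewrite bnd_simp//; lra.
  apply: (in_Lp_integrable (lexx 1%E)).
  by apply: (in_Lp_of_bounded (M := c * (M + M))) => //; exact: measurable_funTS.
have zLp : in_Lp p 0 1 (profile_wave 0).
  have mz := subspace_continuous_measurable_fun (measurable_itv `[0, 1]) cont.
  have [B [_ HB]] := compact_bounded (continuous_compact cont (@segment_compact R 0 1)).
  apply: (in_Lp_of_bounded (M := `|B| + 1)) => //.
    by apply: measurable_funS mz => //; apply: subset_itv; rewrite bnd_simp.
  move=> x /andP[x0 x1]; apply: (HB (`|B| + 1)).
    by rewrite (le_lt_trans (ler_norm B))// ltrDl.
  by exists x => //=; rewrite in_itv/= !ltW.
split; first split=> //; first by exists w.
  by rewrite /= repr ?lexx ?ler01// set_itv1 Rintegral_set1.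
apply: (in_Lp_of_bounded (M := (M + M) / Num.sqrt 2)) => //.
  apply: measurable_funTS; apply: measurable_funM; last exact: measurable_cst.
  apply: measurable_funD.
    exact: (measurableT_comp mNg (measure_preserving_shift 0).1).
  exact: (measurableT_comp mg (measure_preserving_reflection 0).1).
move=> x _; rewrite /wave_t normrM (gtr0_norm c0) ler_pM2r//.
by rewrite (le_trans (ler_normD _ _))// lerD// normrN.
Qed.

End ProfileSolution.

(** * Stability *)

Section Stability.
Context {R : realType}.
Local Notation mu := (@lebesgue_measure R).
Variables (Sigma : set (R * R)) (S : R -> set R).
Hypothesis hSigma : damping_set Sigma.
Hypothesis hS : graph_of S = rotation @` Sigma.

Let S00 : S 0 0. Proof. exact: map_of_damping0 hS hSigma. Qed.

Let Sle x y : S x y -> `|y| <= `|x|.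
Proof. by move=> Sxy; exact: (map_of_damping_le hS hSigma Sxy). Qed.

Lemma energy_ge0 (p : \bar R) z f g t : (0 <= energy p z f g t)%E.
Proof.
rewrite /energy /X_norm; case: p => [q| |//]; first exact: poweR_ge0.
rewrite mule_ge0 ?lee_fin ?invr_ge0 ?sqrtr_ge0// le_max.
by apply/orP; left; exact: Lnorm_ge0.
Qed.

Lemma bounded_family (X : nat -> nat -> R) (M : R) :
  (forall k, iterated_sequence S (X k)) -> (forall k, `|X k 0%N| <= M) ->
  forall s, `|step_profile X s| <= M.
Proof.
move=> XS XM s; rewrite /step_profile; set k := Num.truncn _.
by apply: le_trans (XM k); exact: (iterated_sequence_le Sle (XS k) (leq0n _)).
Qed.

(** Strong stability, applied to the solution that runs through the family. *)
Lemma strongly_stable_step (p : \bar R) (X : nat -> nat -> R) (M : R) :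
  (1 <= p)%E -> strongly_stable Sigma p ->
  (forall k, iterated_sequence S (X k)) -> (forall k, `|X k 0%N| <= M) ->
  exists z0 z1 z f g, [/\ solution Sigma p z0 z1 z f g,
    forall s, -1 < s -> outgoing g s = step_profile X s
    & forall eps : R, 0 < eps -> exists T, forall t, T <= t ->
        (energy p z f g t <= eps%:E)%E].
Proof.
move=> p1 stab XS XM.
have mX := measurable_step_profile X.
have bX := bounded_family XS XM.
have iX s : -1 <= s -> S (step_profile X s) (step_profile X (s + 2)).
  exact: step_profile_iterates.
have sol := profile_wave_solution hS p1 mX bX iX.
have inX := profile_wave_in_X hS p1 mX bX iX.
do 5 eexists; split; first exact: sol.
  by move=> s s1; rewrite outgoingE.
apply/cvge0_pinftyP; last exact: stab inX sol.
by move=> t _; exact: energy_ge0.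
Qed.

(** A single sequence used on the whole period gives a solution whose energy at
    time [2 n] is [2 ^ (1 / q) |x n|]. *)
Lemma simple_of_strongly_stable (q : R) : 1 <= q ->
  strongly_stable Sigma q%:E -> converge_simply_to_zero S.
Proof.
move=> q1 stab x xS.
have q0 : 0 < q by exact: lt_le_trans q1.
have [z0 [z1 [z [f [g [sol gE H]]]]]] :=
  strongly_stable_step (p := q%:E) (X := fun=> x) (M := `|x 0%N|) q1 stab (fun=> xS) (fun=> lexx _).
apply/cvgr0Pnorm_le => e e0; have [T HT] := H e e0.
near=> n.
have n0 : 0 <= 2 * n%:R :> R by rewrite mulr_ge0.
have Tn : T <= 2 * n%:R.
  have : T <= n%:R by near: n; exact: nbhs_infty_ger.
  have : 0 <= n%:R :> R by []. lra.
have := HT _ Tn; rewrite (energy_Lp (p := q%:E) _ sol)//.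
have -> : (\int[mu]_(s in `](2 * n%:R - 1)%R, (2 * n%:R + 1)%R[)
    (`|outgoing g s| `^ q)%:E = (`|x n| `^ q * 2)%:E)%E.
  transitivity (\int[mu]_(s in `](2 * n%:R - 1)%R, (2 * n%:R + 1)%R[)
      (cst (`|x n| `^ q)%:E) s)%E.
    apply: eq_integral => s /set_mem /=; rewrite in_itv/= => /andP[s1 s2].
    rewrite gE; last by lra.
    by rewrite (@step_profile_constant_family R x n s)// s2 ltW.
  rewrite integral_cst; last exact: measurable_itv.
  rewrite -[X in (_ * X)%E]/(mu `]2 * n%:R - 1, 2 * n%:R + 1[%classic).
  rewrite lebesgue_measure_itv/= lte_fin ifT; last by lra.
  by rewrite -EFinD -EFinM; congr (_ * _)%:E; ring.
rewrite lee_fin; apply: le_trans.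
rewrite -[leLHS]powRr1// -[X in _ `^ X <= _](mulfV (lt0r_neq0 q0)) powRrM.
rewrite ge0_ler_powR ?nnegrE ?invr_ge0 ?mulr_ge0 ?powR_ge0 ?(ltW q0)//.
by rewrite ler_peMr ?powR_ge0// ler1n.
Unshelve. all: by end_near. Qed.

Lemma strongly_stable_of_simple (q : R) : 1 <= q ->
  converge_simply_to_zero S -> strongly_stable Sigma q%:E.
Proof.
move=> q1 S0 z0 z1 z f g _ sol.
have q0 : 0 < q by exact: lt_le_trans q1.
apply/cvge0_pinftyP => [t _|e e0]; first exact: energy_ge0.
have lG := outgoing_locally_integrable (p := q%:E) q1 sol.
have GS := outgoing_iterates hS (p := q%:E) q1 sol.
have iq : mu.-integrable `](-1)%R, 1%R[ (fun s => (`|outgoing g s| `^ q)%:E).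
  have m11 : -1 < 1 :> R by lra.
  case: sol => _ gL _ _ _.
  have := in_Lp_powR_integrable q1 (gL 1 m11).
  apply: eq_integrable => // s /set_mem /=; rewrite in_itv/= => /andP[s1 _].
  by rewrite outgoingE.
have eq0 : 0 < e `^ q by exact: powR_gt0.
have [T HT] := Lp_window_cvg0 Sle lG GS q1 iq S0 eq0.
exists (Num.max 0 T) => t; rewrite ge_max => /andP[t0 Tt].
rewrite (energy_Lp (p := q%:E) q1 sol)//.
have -> : e%:E = ((e `^ q)%:E `^ q^-1)%E.
  by rewrite poweR_EFin -powRrM mulfV ?powRr1 ?gt_eqF// ltW.
apply: gt0_ler_poweR; rewrite ?invr_ge0 ?(ltW q0)//.
- by rewrite in_itv/= leey andbT integral_ge0// => s _; rewrite lee_fin powR_ge0.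
- by rewrite in_itv/= leey andbT lee_fin powR_ge0.
- exact: HT.
Qed.

Lemma strongly_stable_of_UGAS (p : \bar R) :
  UGAS Sigma p -> strongly_stable Sigma p.
Proof.
move=> [beta [_ _ _ _ b0] Hb] z0 z1 z f g inX sol.
apply/cvge0_pinftyP => [t _|e e0]; first exact: energy_ge0.
have r0 : 0 <= fine (energy p z f g 0) by rewrite fine_ge0// energy_ge0.
have [T [_ HT]] : \forall t \near +oo, beta (fine (energy p z f g 0)) t < e.
  by apply: (cvgr_lt (0 : R)); [exact: b0|].
exists (Num.max 0 (T + 1)) => t; rewrite ge_max => /andP[t0 Tt].
apply: le_trans (Hb _ _ _ _ _ inX sol t t0) _.
by rewrite lee_fin ltW//; apply: HT; rewrite (lt_le_trans _ Tt)// ltrDl.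
Qed.

(** If uniform convergence fails, monotonicity of absolute values along iterated
    sequences provides for each [k] a sequence that starts in the ball of
    radius [r] and whose [k]-th term is at least [eps].  On the interval
    attached to the [k]-th sequence the pasted profile is that large at time
    [2 k], and the essential supremum sees it since the interval has positive
    length. *)
Lemma uniform_of_strongly_stable :
  strongly_stable Sigma +oo%E -> converge_uniformly_to_zero S.
Proof.
move=> stab r eps r0 eps0; apply: contrapT => nN.
have bad N : exists x, [/\ iterated_sequence S x, `|x 0%N| <= r & eps <= `|x N|].
  apply: contrapT => nx; apply: nN; exists N => x0 x0r x xS xx0 n Nn.
  rewrite ltNge; apply/negP => epsx; apply: nx; exists x; split=> //.
    by rewrite xx0.
  exact: le_trans epsx (iterated_sequence_le Sle xS Nn).
have [X HX] := choice bad.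
have XS k : iterated_sequence S (X k) by have [] := HX k.
have XM k : `|X k 0%N| <= r by have [] := HX k.
have y1 : (1 <= +oo :> \bar R)%E by exact: leey.
have [z0 [z1 [z [f [g [sol gE H]]]]]] := strongly_stable_step y1 stab XS XM.
have e2 : 0 < eps / 2 by rewrite divr_gt0.
have [T HT] := H _ e2.
(* With [m = n + 1], time [2 m] exceeds [T]. *)
pose n := Num.truncn `|T|.
have nT : T <= 2 * n.+1%:R.
  have := truncnS_gt `|T|; rewrite -/n => h.
  by have := ler_norm T; have : 0 <= n.+1%:R :> R by []; lra.
have n0 : 0 <= 2 * n.+1%:R :> R by rewrite mulr_ge0.
have := HT _ nT; rewrite (energy_Loo_leP y1 sol n0 (ltW e2)).
set m := n.+1 => Hae.
have em : expR (- m.+1%:R) < expR (- m%:R) :> R.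
  by rewrite ltr_expR ltrN2 ltr_nat.
have e0 : 0 < expR (- m.+1%:R) :> R by exact: expR_gt0.
have e1 : expR (- m%:R) <= 1 :> R by rewrite expR_le1 oppr_le0.
have lt : 2 * m%:R - 1 + 2 * expR (- m.+1%:R) < 2 * m%:R - 1 + 2 * expR (- m%:R) :> R.
  by rewrite ltrD2l ltr_pM2l.
have [s /andP[s1 s2]] := ae_itv_witness lt Hae.
rewrite gE; last by rewrite -/m in n0; lra.
rewrite (@step_profile_piece R X m m s) ?s1 ?s2//.
have [_ _ Xm] := HX m; move=> Hs.
have : `|X m m| <= eps / 2 by apply: Hs; apply/andP; split; lra.
by lra.
Qed.

(** The initial energy bounds the profile on [(-1, 1)], where almost every point
    starts an iterated sequence. *)
Lemma UGAS_of_uniform : converge_uniformly_to_zero S -> UGAS Sigma +oo%E.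
Proof.
move=> Sunif; exists (KL_bound S); first exact: KL_KL_bound.
move=> z0 z1 z f g inX sol t t0.
have y1 : (1 <= +oo :> \bar R)%E by exact: leey.
have [M M0 gM] : exists2 M : R, 0 <= M &
    {ae mu, forall s, -1 < s < 1 -> `|g s| <= M}.
  by case: (sol) => _ gL _ _ _; apply: in_Loo_bounded; apply: gL; lra.
have E0M : (energy +oo%E z f g 0 <= M%:E)%E.
  apply/(energy_Loo_leP y1 sol (lexx 0) M0); apply: ae_imply gM => s Hs s1.
  by rewrite outgoingE; [apply: Hs|]; lra.
set r := fine _.
have rE : r%:E = energy +oo%E z f g 0.
  by rewrite fineK// ge0_fin_numE ?energy_ge0// (le_lt_trans E0M)// ltry.
have r0 : 0 <= r by rewrite fine_ge0// energy_ge0.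
have Gr : {ae mu, forall s, -1 < s < 1 -> `|outgoing g s| <= r}.
  have : (energy +oo%E z f g 0 <= r%:E)%E by rewrite rE.
  move/(energy_Loo_leP y1 sol (lexx 0) r0); apply: ae_imply => s Hs s1.
  by apply: Hs; rewrite sub0r add0r.
have [_ K0 _ _ _] := KL_KL_bound S00 Sle Sunif.
apply/(energy_Loo_leP y1 sol t0 (K0 _ _ r0 t0)).
apply: (ae_iterated_window (outgoing_iterates hS y1 sol) t0 Gr).
by move=> x xS xr n tn; exact: le_KL_bound.
Qed.

End Stability.

Theorem proposition32 (R : realType) (Sigma : set (R * R)) (S : R -> set R)
    (p : \bar R) (hSigma : damping_set Sigma) (hS : graph_of S = rotation @` Sigma)
    (hp : (1 <= p)%E) :
  ((p < +oo)%E -> (strongly_stable Sigma p <-> converge_simply_to_zero S)) /\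
  (p = +oo%E ->
     (UGAS Sigma p <-> strongly_stable Sigma p) /\
     (strongly_stable Sigma p <-> converge_uniformly_to_zero S)).
Proof.
split.
  case: p hp => [q q1 _| |]//; split.
    exact: simple_of_strongly_stable.
  exact: strongly_stable_of_simple.
move=> ->; split; split.
- exact: strongly_stable_of_UGAS.
- by move=> /(uniform_of_strongly_stable hSigma hS); exact: UGAS_of_uniform.
- exact: uniform_of_strongly_stable.
- by move=> /(UGAS_of_uniform hSigma hS); exact: strongly_stable_of_UGAS.
Qed.
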